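(* Let $n\ge 2$ be an integer and let $\Theta=(\theta_1,\dots,\theta_n)\in\mathbf{R}^n$ be such that $1,\theta_1,\dots,\theta_n$ are linearly independent over $\mathbf{Q}$. For any integer $d$ with $0\le d\le n-2$, $$\omega_{d+1}(\Theta)\ge\frac{(n-d)\,\omega_d(\Theta)+1}{n-d-1}.$$ Furthermore, $$\omega_1(\Theta)\ge\frac{\omega_0(\Theta)+\hat\omega_0(\Theta)}{1-\hat\omega_0(\Theta)}.$$
   Context: Identify $\Theta$ with the point of $\mathbf{P}^n(\mathbf{R})$ with homogeneous coordinates $(1,\theta_1,\dots,\theta_n)$. Equip $\mathbf{R}^{n+1}$ with the standard scalar product and its exterior algebra with the induced Euclidean norm $|\cdot|$ (wedge products of an orthonormal basis form an orthonormal basis). The projective distance between $P,Q\in\mathbf{P}^n(\mathbf{R})$ with homogeneous coordinates $\mathbf{x},\mathbf{y}$ is $\mathrm{d}(P,Q)=|\mathbf{x}\wedge\mathbf{y}|/(|\mathbf{x}||\mathbf{y}|)$, and for a linear subvariety $L$ of $\mathbf{P}^n(\mathbf{R})$, $\mathrm{d}(\Theta,L)=\min_{P\in L}\mathrm{d}(\Theta,P)$. If $L=\mathbf{P}(V)$ is rational over $\mathbf{Q}$ of dimension $d$, its height is $H(L)=|\mathbf{X}|$, where $\mathbf{X}\in\Lambda^{d+1}(\mathbf{Z}^{n+1})$ is a system of coprime integer Plücker coordinates of $V$. For $0\le d\le n-1$, $\omega_d(\Theta)$ is the supremum (possibly $+\infty$) of the real numbers $\omega$ for which there exist infinitely many rational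 linear subvarieties $L\subset\mathbf{P}^n(\mathbf{R})$ with $\dim L=d$ and $\mathrm{d}(\Theta,L)\le H(L)^{-1-\omega}$. $\hat\omega_0(\Theta)$ is the supremum of the real numbers $\omega$ such that for all sufficiently large real $X$ there exists a non-zero integer $(n+1)$-tuple $(x_0,\dots,x_n)$ with $\max_{0\le i\le n}|x_i|\le X$ and $\max_{1\le i\le n}|x_0\theta_i-x_i|\le X^{-\omega}$. Convention: a right-hand side is $+\infty$ if $\omega_d(\Theta)=+\infty$ (resp. $\omega_0(\Theta)=+\infty$ or $\hat\omega_0(\Theta)=1$; one always has $\hat\omega_0(\Theta)\le 1$). *)

(* Defs.v *)
From mathcomp Require Import all_boot all_order all_algebra.
From mathcomp Require Import all_classical all_reals all_analysis.

Set Implicit Arguments.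
Unset Strict Implicit.
Unset Printing Implicit Defensive.

Import Order.TTheory GRing.Theory Num.Theory.
Import numFieldNormedType.Exports.

Local Open Scope classical_set_scope.
Local Open Scope ring_scope.

(* The norm `|x| of MathComp-Analysis on row vectors is the sup norm, hence
   this separate Euclidean norm. *)
Definition l2norm (R : realType) (I : finType) (F : I -> R) : R :=
  Num.sqrt (\sum_(i : I) F i ^+ 2).

(* Multi-indices i_0 < ... < i_(k-1) < m: they index the orthonormal basis
   e_(i_0) /\ ... /\ e_(i_(k-1)) of the k-th exterior power of R^m. *)
Definition increasing (k m : nat) (f : {ffun 'I_k -> 'I_m}) : bool :=
  [forall i : 'I_k, forall j : 'I_k, (i < j)%N ==> (f i < f j)%N].

Definition multiindex (k m : nat) : finType :=
  {f : {ffun 'I_k -> 'I_m} | increasing f}.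

(* The k-th exterior power of T^m, in coordinates. *)
Definition multivector (T : Type) (k m : nat) : Type :=
  {ffun multiindex k m -> T}.

(* b_0 /\ ... /\ b_(k-1): its coordinate on e_(i_0) /\ ... /\ e_(i_(k-1)) is the
   minor of the matrix with rows b on the columns i_0, ..., i_(k-1). *)
Definition wedge (R : realType) (k m : nat) (b : k.-tuple 'rV[R]_m) :
    multivector R k m :=
  [ffun I : multiindex _ _ => \det (\matrix_(i < k, j < k) tnth b i 0 (val I j))].

Definition proj_dist (R : realType) (m : nat) (x y : 'rV[R]_m) : R :=
  l2norm (wedge [tuple x; y]) / (l2norm (x 0) * l2norm (y 0)).

(* Distance from the point x to P(V); the infimum is a minimum by compactness
   of P(V). *)
Definition proj_dist_sub (R : realType) (m : nat) (x : 'rV[R]_m)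
    (V : {vspace 'rV[R]_m}) : R :=
  inf [set proj_dist x y | y in [set y : 'rV[R]_m | y \in V /\ y != 0]].

Definition rational_subspace (R : realType) (m : nat)
    (V : {vspace 'rV[R]_m}) : Prop :=
  exists s : seq 'rV[rat]_m, V = <<[seq map_mx ratr v | v <- s]>>%VS.

(* The scalar c accounts for homogeneity. *)
Definition plucker_coordinates (R : realType) (m : nat)
    (V : {vspace 'rV[R]_m}) (X : multivector R (\dim V) m) : Prop :=
  exists (b : (\dim V).-tuple 'rV[R]_m) (c : R),
    [/\ basis_of V b, c != 0 & forall I, X I = c * wedge b I].

Definition coprime_multivector (k m : nat) (X : multivector int k m) : Prop :=
  (\big[gcdn/0]_(I : multiindex k m) `|X I|)%N = 1%N.

(* The value 0 is only taken when V is not rational; otherwise the system X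
   exists and is unique up to sign. *)
Definition height (R : realType) (m : nat) (V : {vspace 'rV[R]_m}) : R :=
  xget 0 [set h | exists X : multivector int (\dim V) m,
    [/\ coprime_multivector X,
        plucker_coordinates (V := V) [ffun I : multiindex _ _ => (X I)%:~R] &
        h = l2norm (fun I => (X I)%:~R : R)]].

Definition hcoord (R : realType) (n : nat) (theta : 'rV[R]_n) : 'rV[R]_n.+1 :=
  row_mx (1%:M : 'rV[R]_1) theta.

Definition lin_indep_over_Q (R : realType) (m : nat) (x : 'rV[R]_m) : Prop :=
  forall a : 'I_m -> rat,
    \sum_(i < m) ratr (a i) * x 0 i = 0 -> forall i, a i = 0.

(* A linear subvariety L = P(V) of dimension d is given by V, of dimension
   d + 1. *)
Definition omega (R : realType) (n d : nat) (theta : 'rV[R]_n) : \bar R :=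
  ereal_sup [set w%:E | w in [set w : R |
    infinite_set [set V : {vspace 'rV[R]_n.+1} |
      [/\ rational_subspace V, \dim V = d.+1 &
          proj_dist_sub (hcoord theta) V <= height V `^ (- 1 - w)]]]].

Definition omega_hat0 (R : realType) (n : nat) (theta : 'rV[R]_n) : \bar R :=
  ereal_sup [set w%:E | w in [set w : R |
    \forall X \near +oo, exists x : 'rV[int]_n.+1,
      [/\ x != 0,
          forall i : 'I_n.+1, `|(x 0 i)%:~R| <= X &
          forall i : 'I_n,
            `|(x 0 ord0)%:~R * theta 0 i - (x 0 (lift ord0 i))%:~R|
              <= X `^ (- w)]]].

(* Main.v *)
Require Import Defs.
From mathcomp Require Import all_boot all_order all_algebra perm.
From mathcomp Require Import all_classical all_reals all_analysis.
From mathcomp Require Import ring lra zify.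
Set Implicit Arguments.
Unset Strict Implicit.
Unset Printing Implicit Defensive.
Import Order.TTheory GRing.Theory Num.Theory.

(** Write H for the height, d for the projective distance, m = n + 1, and
T = (1, theta_1, .., theta_n). Both inequalities come from enlarging rational
subspaces that are close to T.

Going up by one dimension. Let V be rational of dimension d + 1, and put
r = n - d. The lattice Z^m / (V /\ Z^m) has rank r and covolume 1 / H(V), so it
contains a nonzero vector of norm << H(V)^(-1/r). Adjoining it to V gives a
rational W of dimension d + 2 with H(W) << H(V)^(1 - 1/r) [going_up], while
d(T, W) <= d(T, V) because V is contained in W. If d(T, V) <= H(V)^(-1-w),
this says d(T, W) << H(W)^(-(1+w) r / (r-1)), which is the exponent of the
first inequality [omega_going_up]. The short lattice vector is produced by a
pigeonhole argument [small_vector_mod_subspace] on the fractional parts of the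
points of V over a box of a triangular basis of V /\ Z^m [triangular_basis].

Planes. Let y be a primitive point on a line V with d(T, V) <= H(V)^(-1-w), and
let h be an exponent admissible for the uniform problem. With X a small multiple
of H = H(V) = |y|, the uniform problem provides an integer point x with |x| <= X
and error << H^(-h); it is not on V because it is shorter than y. The plane W
through x and y satisfies H(W) << H^(1-h) and d(T, W) H(W) << H^(-w-h)
[plane_through, good_planes]. Eliminating H gives d(T, W) << H(W)^(-1 - w1) with
w1 = (w + h) / (1 - h); since H(W) >= 1, the case h > 1 is impossible.

From inequalities between heights and distances to exponents. A proper rational
subspace is at positive distance from T [proj_dist_sub_gt0], and there are
finitely many rational subspaces of bounded height [finite_height_le]. Hence a
family of subspaces whose distances to T tend to 0 is infinite with heights
tending to infinity, and constants may be absorbed in the exponents [omega_ge].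
A pigeonhole argument [dirichlet] shows that some h > 0 is admissible in the
uniform problem; consequently all the exponents that occur are positive, and no
degenerate value such as -oo disturbs the final computations in the extended
reals. *)

Import numFieldNormedType.Exports.
Local Open Scope classical_set_scope.
Local Open Scope ring_scope.

(** * Minors and bases of subspaces *)

(** The columns are selected by an arbitrary map: selections that are not
increasing occur before sorting. *)
Definition minor (A : comPzRingType) (k m : nat) (B : 'M[A]_(k, m))
  (f : 'I_k -> 'I_m) : A := \det (colsub f B).

Definition intr_mx (R : pzRingType) (k m : nat) (B : 'M[int]_(k, m)) : 'M[R]_(k, m) :=
  map_mx intr B.

Definition rows (A : Type) (k m : nat) (B : 'M[A]_(k, m)) : k.-tuple 'rV[A]_m :=
  [tuple row i B | i < k].

Lemma tnth_rows (A : Type) (k m : nat) (B : 'M[A]_(k, m)) i : tnth (rows B) i = row i B.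
Proof. by rewrite tnth_mktuple. Qed.

Definition basis_mx (R : realType) (k m : nat) (V : {vspace 'rV[R]_m})
  (B : 'M[R]_(k, m)) : bool := basis_of V (rows B).

Lemma mulmx_row_tuple (R : realType) (k m : nat) (B : 'M[R]_(k, m)) (u : 'rV_k) :
  u *m B = \sum_(i < k) u 0 i *: (rows B)`_i.
Proof. by rewrite mulmx_sum_row; apply: eq_bigr => i _; rewrite -tnth_nth tnth_mktuple. Qed.

Lemma mem_basis_mx (R : realType) (k m : nat) (V : {vspace 'rV[R]_m})
  (B : 'M[R]_(k, m)) v : basis_mx V B -> reflect (exists u, v = u *m B) (v \in V).
Proof.
move=> BV; apply: (iffP idP) => [/(coord_basis BV) ->|[u ->]].
  exists (\row_i coord (rows B) i v).
  by rewrite mulmx_row_tuple; apply: eq_bigr => i _; rewrite mxE.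
rewrite mulmx_row_tuple rpred_sum // => i _; rewrite rpredZ //.
by apply: (basis_mem BV); rewrite mem_nth // size_tuple.
Qed.

Lemma basis_mx_row_free (R : realType) (k m : nat) (V : {vspace 'rV[R]_m})
  (B : 'M[R]_(k, m)) : basis_mx V B -> row_free B.
Proof.
move=> BV; have /freeP fB := basis_free BV.
rewrite -kermx_eq0; apply/rowV0P => u /sub_kermxP; rewrite mulmx_row_tuple => /fB u0.
by apply/rowP => i; rewrite u0 mxE.
Qed.

Lemma row_free_basis_mx (R : realType) (k m : nat) (B : 'M[R]_(k, m)) :
  row_free B -> basis_mx <<rows B>>%VS B.
Proof.
move=> fB; rewrite /basis_mx /basis_of eqxx andTb; apply/freeP => u.
move=> u0; have : (\row_i u i) *m B = 0.
  by rewrite mulmx_row_tuple -{}[RHS]u0; apply: eq_bigr => i _; rewrite mxE.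
move/eqP; rewrite mulmx_free_eq0 // => /eqP /rowP uz i.
by have := uz i; rewrite !mxE.
Qed.

Lemma basis_mxP (R : realType) (k m : nat) (V : {vspace 'rV[R]_m})
  (B : 'M[R]_(k, m)) : \dim V = k -> (forall i, row i B \in V) -> row_free B -> basis_mx V B.
Proof.
move=> dV BV fB; rewrite /basis_mx basisEfree.
have /basis_free -> := row_free_basis_mx fB.
rewrite size_tuple dV leqnn andbT /=; apply/span_subvP => v /(tnthP (rows B))[i ->].
by rewrite tnth_rows.
Qed.

Lemma dim_basis_mx (R : realType) (k m : nat) (V : {vspace 'rV[R]_m})
  (B : 'M[R]_(k, m)) : basis_mx V B -> \dim V = k.
Proof. exact: size_basis. Qed.

Lemma basis_mx_row (R : realType) (k m : nat) (V : {vspace 'rV[R]_m})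
  (B : 'M[R]_(k, m)) i : basis_mx V B -> row i B \in V.
Proof. by move=> BV; apply/(mem_basis_mx _ BV); exists (delta_mx 0 i); rewrite rowE. Qed.

Lemma minor_mul (A : comNzRingType) (k m : nat) (S : 'M[A]_k) (B : 'M[A]_(k, m)) f :
  minor (S *m B) f = \det S * minor B f.
Proof. by rewrite /minor -mulmx_colsub det_mulmx. Qed.

Lemma minor_intr (R : comNzRingType) (k m : nat) (B : 'M[int]_(k, m)) f :
  minor (intr_mx R B) f = (minor B f)%:~R.
Proof. by rewrite /minor -det_map_mx; congr (\det _); apply/matrixP => i j; rewrite !mxE. Qed.

Lemma multiindex_inj (k m : nat) (I : multiindex k m) : injective (val I).
Proof.
move=> i j eI; apply: val_inj; apply/eqP; rewrite eqn_leq.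
have H := valP I; apply/andP; split; rewrite leqNgt; apply/negP => lt;
  by move/forallP: H => /(_ _)/forallP/(_ _)/implyP/(_ lt); rewrite eI ltnn.
Qed.

(** Some selection of columns has a nonzero minor, and sorting this selection only
changes the sign. *)
Lemma minor_neq0_multiindex (F : fieldType) (k m : nat) (B : 'M[F]_(k, m)) :
  row_free B -> exists I : multiindex k m, minor B (val I) != 0.
Proof.
move=> fB; have BT : row_full B^T by rewrite /row_full mxrank_tr.
pose f := fullrankfun BT; have finj : injective f by move=> i j; exact: (@fullrankfun_inj _ _ _ B^T BT).
have dB : minor B f != 0.
  have e : (colsub f B)^T = rowsub f B^T by apply/matrixP => i j; rewrite !mxE.
  by rewrite -unitfE /minor -det_tr e -unitmxE; exact: fullrowsub_unit.
pose S := f @: 'I_k.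
have cS : #|S| = k by rewrite card_imset // card_ord.
pose h (i : 'I_k) : 'I_m := Order.enum_val (cast_ord (esym cS) i : 'I_#|S|).
have hS i : h i \in S by exact: Order.EnumVal.enum_valP.
have hi : forall i, exists j, f j == h i.
  by move=> i; have /imsetP[j _ ->] := hS i; exists j.
pose s i := xchoose (hi i).
have fs i : f (s i) = h i by apply/eqP; exact: xchooseP (hi i).
have hinj : injective h.
  by move=> i j /Order.EnumVal.enum_val_inj /cast_ord_inj.
have sinj : injective s by move=> i j eij; apply: hinj; rewrite -!fs eij.
have hinc : increasing [ffun i => h i].
  apply/forallP => i; apply/forallP => j; apply/implyP => lt; rewrite !ffunE.
  have e : (h i < h j)%O = (i < j)%N.
    exact: leW_mono (Order.EnumVal.le_enum_val (@le_total _ 'I_m) (A := S)) _ _.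
  by rewrite -e in lt.
exists (exist (fun g : {ffun _ -> _} => is_true (increasing g)) _ hinc) => /=.
have -> : minor B [ffun i => h i] = \det (colsub f B *m perm_mx (perm sinj)^-1%g).
  rewrite /minor -col_permE; congr (\det _); apply/matrixP => i j.
  by rewrite !mxE [in LHS]ffunE permE fs.
rewrite det_mulmx; apply: mulf_neq0; first exact: dB.
by rewrite det_perm signr_eq0.
Qed.

(** * Integer bases and heights *)

Lemma clear_denominators (m : nat) (v : 'rV[rat]_m) :
  exists (N : int) (z : 'rV[int]_m),
    N != 0 /\ forall i, N%:~R * v 0 i = (z 0 i)%:~R.
Proof.
exists (\prod_i denq (v 0 i)), (\row_i ((\prod_(j | j != i) denq (v 0 j)) * numq (v 0 i))).
split; first by apply/prodf_neq0 => i _; rewrite denq_neq0.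
move=> i; rewrite mxE (bigD1 i) //= [LHS]mulrC !intrM mulrA -numqE; ring.
Qed.

(** Greedily keep the generators outside the span of those already kept, multiplied
by a common denominator. *)
Lemma rational_subspace_int_basis (R : realType) (m : nat) (V : {vspace 'rV[R]_m}) :
  rational_subspace V -> exists B : 'M[int]_(\dim V, m), basis_mx V (intr_mx R B).
Proof.
case=> s Vs.
suff [t [ft tE]] : exists t : seq 'rV[int]_m, free [seq intr_mx R v | v <- t] /\
    <<[seq intr_mx R v | v <- t]>>%VS = <<[seq map_mx ratr v | v <- s]>>%VS.
  have dV : \dim V = size t by rewrite Vs -tE (eqnP ft) size_map.
  rewrite dV; exists (\matrix_(i < size t) nth 0 t i).
  rewrite /basis_mx /basis_of.
  suff -> : rows (intr_mx R (\matrix_(i < size t) nth 0 t i)) = [seq intr_mx R v | v <- t] :> seq _.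
    by rewrite ft tE Vs eqxx.
  apply: (@eq_from_nth _ (0 : 'rV[R]_m)); first by rewrite size_tuple size_map.
  move=> i; rewrite size_tuple => lt; rewrite (nth_map 0) //.
  rewrite -[i]/(val (Ordinal lt)) -tnth_nth tnth_rows.
  by apply/rowP => j; rewrite !mxE.
elim: s {V Vs} => [|v s [t [ft tE]]]; first by exists [::]; rewrite nil_free.
have [N [z [N0 zE]]] := clear_denominators v.
have NR : (N%:~R : R) != 0 by rewrite intr_eq0.
have zv : intr_mx R z = N%:~R *: map_mx ratr v.
  apply/rowP => i; rewrite !mxE.
  by have := congr1 (@ratr R) (zE i); rewrite rmorphM /= !ratr_int => ->.
have lv : (<[intr_mx R z]> = <[map_mx ratr v]> :> {vspace 'rV[R]_m})%VS.
  rewrite zv; apply/vspaceP => x; apply/vlineP/vlineP => -[a ->].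
    by exists (a * N%:~R); rewrite scalerA.
  by exists (a / N%:~R); rewrite scalerA divfK.
case: (boolP (map_mx ratr v \in <<[seq intr_mx R v | v <- t]>>%VS)) => vt.
  exists t; split => //; rewrite [in RHS]/= span_cons -tE.
  by apply/esym/addv_idPr; rewrite -memvE.
exists (z :: t); split; rewrite /=; last by rewrite !span_cons tE lv.
rewrite free_cons ft andbT.
by rewrite memvE lv -memvE.
Qed.

Lemma wedge_minor (R : realType) (k m : nat) (b : k.-tuple 'rV[R]_m) I :
  wedge b I = minor (\matrix_i tnth b i) (val I).
Proof. by rewrite ffunE; congr (\det _); apply/matrixP => i j; rewrite !mxE. Qed.

Lemma rows_matrix (R : realType) (k m : nat) (b : k.-tuple 'rV[R]_m) :
  rows (\matrix_i tnth b i) = b.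
Proof. by apply: eq_from_tnth => i; rewrite tnth_rows rowK. Qed.

Lemma matrix_rows (R : realType) (k m : nat) (B : 'M[R]_(k, m)) :
  \matrix_i tnth (rows B) i = B.
Proof. by apply/row_matrixP => i; rewrite rowK tnth_rows. Qed.

Lemma basis_mx_change (R : realType) (k m : nat) (V : {vspace 'rV[R]_m})
  (B C : 'M[R]_(k, m)) : basis_mx V B -> basis_mx V C -> exists2 S, \det S != 0 & C = S *m B.
Proof.
move=> BV CV.
have [S CE] : exists S, C = S *m B.
  exists (C *m pinvmx B); rewrite mulmxKpV //; apply/row_subP => i.
  have /(mem_basis_mx _ BV)[u ->] : row i C \in V by exact: basis_mx_row CV.
  exact: submxMl.
exists S => //; rewrite -unitfE -unitmxE -row_free_unit -kermx_eq0.
apply/rowV0P => u /sub_kermxP uS.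
have /eqP : u *m C = 0 by rewrite CE mulmxA uS mul0mx.
by rewrite mulmx_free_eq0 ?(basis_mx_row_free CV) // => /eqP.
Qed.

Definition minor_gcd (k m : nat) (B : 'M[int]_(k, m)) : nat :=
  \big[gcdn/0%N]_(I : multiindex k m) `|minor B (val I)|%N.

Lemma minor_gcd_dvd (k m : nat) (B : 'M[int]_(k, m)) (I : multiindex k m) :
  (minor_gcd B %| `|minor B (val I)|)%N.
Proof. exact: (biggcdn_inf I). Qed.

Lemma minor_gcd_gt0 (R : realType) (k m : nat) (B : 'M[int]_(k, m)) :
  row_free (intr_mx R B) -> (0 < minor_gcd B)%N.
Proof.
move=> /minor_neq0_multiindex[I]; rewrite minor_intr intr_eq0 => BI.
by have := minor_gcd_dvd B I; case: (minor_gcd B) => //; rewrite dvd0n absz_eq0 (negPf BI).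
Qed.

Lemma biggcdnMl (I : finType) (a : nat) (F : I -> nat) :
  (\big[gcdn/0]_i (a * F i) = a * \big[gcdn/0]_i F i)%N.
Proof.
by apply/esym/(big_morph (muln a)) => [x y|]; rewrite ?muln0 // muln_gcdr.
Qed.

(** The gcd over i of the relations |X_i| |Y_j| = |X_j| |Y_i| is |Y_j| = |X_j|. *)
Lemma coprime_proportional (I : finType) (X Y : I -> int) :
  (\big[gcdn/0]_i `|X i| = 1)%N -> (\big[gcdn/0]_i `|Y i| = 1)%N ->
  (forall i j, X i * Y j = X j * Y i) -> forall i, `|X i|%N = `|Y i|%N.
Proof.
move=> X1 Y1 XY j.
have : (\big[gcdn/0]_i (`|Y j| * `|X i|) = \big[gcdn/0]_i (`|X j| * `|Y i|))%N.
  by apply: eq_bigr => i _; rewrite -!abszM -XY mulrC.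
by rewrite !biggcdnMl X1 Y1 !muln1.
Qed.

(** Dividing the minors of an integer basis by their gcd gives coprime Pluecker
coordinates. Any other coprime system is proportional to them, hence equal up to
sign, so that the height is well defined. *)
Lemma height_basis (R : realType) (k m : nat) (V : {vspace 'rV[R]_m})
  (B : 'M[int]_(k, m)) : basis_mx V (intr_mx R B) ->
  height V * (minor_gcd B)%:R = l2norm (fun I : multiindex k m => (minor B (val I))%:~R : R).
Proof.
move=> BV; have dk := dim_basis_mx BV; subst k.
have fB := basis_mx_row_free BV.
have g0 := minor_gcd_gt0 fB.
have gR : ((minor_gcd B)%:R : R) != 0 by rewrite pnatr_eq0 -lt0n.
pose X0 (I : multiindex (\dim V) m) : int := (minor B (val I) %/ (minor_gcd B)%:Z)%Z.
have X0E I : X0 I * (minor_gcd B)%:Z = minor B (val I).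
  by rewrite /X0 divzK // /dvdz; exact: minor_gcd_dvd.
have X01 : (\big[gcdn/0]_I `|X0 I| = 1)%N.
  have : (minor_gcd B * \big[gcdn/0]_I `|X0 I| = minor_gcd B * 1)%N.
    by rewrite muln1 -biggcdnMl; apply: eq_bigr => I _; rewrite -X0E abszM absz_nat mulnC.
  by move/eqP; rewrite eqn_pmul2l // => /eqP.
have l2X : l2norm (fun I => (X0 I)%:~R : R) * (minor_gcd B)%:R =
    l2norm (fun I : multiindex (\dim V) m => (minor B (val I))%:~R : R).
  rewrite /l2norm -[X in _ * X]ger0_norm // -sqrtr_sqr -sqrtrM.
    congr Num.sqrt; rewrite mulr_suml; apply: eq_bigr => I _.
    by rewrite -X0E intrM exprMn.
  by apply: sumr_ge0 => I _; rewrite sqr_ge0.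
rewrite -l2X; congr (_ * _).
rewrite /height; set H := (X in xget _ X).
have HX0 : H (l2norm (fun I => (X0 I)%:~R : R)).
  exists [ffun I => X0 I]; split.
  - by apply: etrans X01; apply: eq_bigr => I _; rewrite ffunE.
  - exists (rows (intr_mx R B)), (minor_gcd B)%:R^-1; split; rewrite ?invr_eq0 //.
    move=> I; rewrite wedge_minor !ffunE matrix_rows minor_intr -X0E intrM.
    by rewrite mulrC mulfK.
  - by rewrite /l2norm; congr Num.sqrt; apply: eq_bigr => I _; rewrite ffunE.
have [X [X1 [b [c [bV c0 Xb]]] ->]] : H (xget 0 H) := xgetPex 0 (ex_intro _ _ HX0).
rewrite /l2norm; congr Num.sqrt; apply: eq_bigr => I _.
suff : `|X I|%N = `|X0 I|%N.
  move=> e; have : `|X I| ^+ 2 = `|X0 I| ^+ 2 by rewrite -!abszE e.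
  by rewrite !real_normK ?num_real // => eq; rewrite -!rmorphXn eq.
apply: (coprime_proportional X1 X01) => {}I J.
have bV' : basis_mx V (\matrix_i tnth b i) by rewrite /basis_mx rows_matrix.
have [S S0 BS] := basis_mx_change bV' BV.
have e K : (X0 K)%:~R * ((minor_gcd B)%:R * c) = \det S * (X K)%:~R :> R.
  have := Xb K; rewrite ffunE => ->; rewrite wedge_minor [RHS]mulrCA -minor_mul -BS minor_intr -X0E intrM.
  by rewrite [RHS]mulrC mulrA.
apply: (@intr_inj R); rewrite !intrM; apply: (mulfI S0).
rewrite mulrA -e mulrA [RHS]mulrA -e; ring.
Qed.

Lemma l2norm_ge (R : realType) (I : finType) (F : I -> R) i : `|F i| <= l2norm F.
Proof.
rewrite -sqrtr_sqr ler_wsqrtr // (bigD1 i) //= lerDl.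
by apply: sumr_ge0 => j _; rewrite sqr_ge0.
Qed.

Lemma l2norm_le (R : realType) (I : finType) (F : I -> R) (M : R) : 0 <= M ->
  (forall i, `|F i| <= M) -> l2norm F <= #|I|%:R * M.
Proof.
move=> M0 FM; have M1 : 0 <= #|I|%:R * M by rewrite mulr_ge0.
rewrite -[leRHS]ger0_norm // -sqrtr_sqr ler_wsqrtr //.
apply: (@le_trans _ _ (\sum_(i : I) M ^+ 2)).
  by apply: ler_sum => i _; rewrite -real_normK ?num_real // lerXn2r ?nnegrE.
rewrite sumr_const exprMn -[leLHS]mulr_natl ler_wpM2r ?sqr_ge0 //.
by rewrite -natrX ler_nat; case: #|I| => // a; rewrite leq_pmulr.
Qed.

Lemma l2norm_ge0 (R : realType) (I : finType) (F : I -> R) : 0 <= l2norm F.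
Proof. exact: sqrtr_ge0. Qed.

Lemma minor_gcd_le_height (R : realType) (k m : nat) (V : {vspace 'rV[R]_m})
  (B : 'M[int]_(k, m)) (I : multiindex k m) : basis_mx V (intr_mx R B) ->
  `|(minor B (val I))%:~R| <= height V * (minor_gcd B)%:R.
Proof.
move=> BV; rewrite (height_basis BV).
exact: (l2norm_ge (fun I : multiindex k m => (minor B (val I))%:~R : R)).
Qed.

Lemma height_ge1 (R : realType) (m : nat) (V : {vspace 'rV[R]_m}) :
  rational_subspace V -> 1 <= height V.
Proof.
move=> /rational_subspace_int_basis[B BV]; have fB := basis_mx_row_free BV.
have g0 := minor_gcd_gt0 fB.
have /minor_neq0_multiindex[I] := fB; rewrite minor_intr intr_eq0 => BI.
have := minor_gcd_le_height I BV.
have gI : (minor_gcd B)%:R <= `|(minor B (val I))%:~R : R|.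
  rewrite -intr_norm -abszE -pmulrn ler_nat dvdn_leq ?minor_gcd_dvd //.
  by rewrite absz_gt0.
move=> /(le_trans gI); rewrite -[leLHS]mul1r ler_pM2r //.
by rewrite ltr0n.
Qed.

(** A common divisor of the minors of an integer basis can be saved on the height.
With g = 1 this bounds the height by any integer basis; a larger g is inherited
from a subspace in [going_up]. *)
Lemma height_le (R : realType) (k m : nat) (V : {vspace 'rV[R]_m})
  (B : 'M[int]_(k, m)) (g : nat) : basis_mx V (intr_mx R B) ->
  (forall I : multiindex k m, (g %| `|minor B (val I)|)%N) ->
  height V * g%:R <= l2norm (fun I : multiindex k m => (minor B (val I))%:~R : R).
Proof.
move=> BV gB; rewrite -(height_basis BV) ler_wpM2l ?ler_nat //.
  have := l2norm_ge0 (fun I : multiindex k m => (minor B (val I))%:~R : R).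
  rewrite -(height_basis BV) pmulr_lge0 // ltr0n.
  by apply: minor_gcd_gt0; exact: basis_mx_row_free BV.
rewrite dvdn_leq //; first by apply: minor_gcd_gt0; exact: basis_mx_row_free BV.
by apply/dvdn_biggcdP => I _.
Qed.

(** * Finiteness of the rational subspaces of bounded height *)

Lemma minor_col_mx (A : comNzRingType) (k m : nat) (u : 'rV[A]_m) (B : 'M[A]_(k, m))
  (f : 'I_(1 + k) -> 'I_m) :
  minor (col_mx u B) f =
  \sum_j u 0 (f j) * ((-1) ^+ j * minor B (f \o lift j)).
Proof.
rewrite /minor (expand_det_row _ ord0); apply: eq_bigr => j _; congr (_ * _).
  by rewrite !mxE; case: splitP => [i _|i /= /eqP]; rewrite ?ord1.
rewrite /cofactor add0n; congr (_ * \det _); apply/matrixP => a b; rewrite !mxE.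
case: splitP => [i /= |i /= /eqP]; first by case: i => -[].
by rewrite /bump /= !add1n eqSS => /eqP e; congr (B _ _); apply: val_inj.
Qed.

Lemma drop_index_increasing (k m : nat) (K : multiindex (1 + k) m) (j : 'I_(1 + k)) :
  increasing [ffun i : 'I_k => val K (lift j i)].
Proof.
apply/forallP => a; apply/forallP => b; apply/implyP => ab; rewrite !ffunE.
have /forallP/(_ (lift j a))/forallP/(_ (lift j b))/implyP := valP K; apply.
by rewrite /= ltnNge leq_bump2 -ltnNge.
Qed.

Definition drop_index (k m : nat) (K : multiindex (1 + k) m) (j : 'I_(1 + k)) : multiindex k m :=
  exist (fun g : {ffun _ -> _} => is_true (increasing g)) _ (drop_index_increasing K j).

Lemma minor_ext (A : comPzRingType) (k m : nat) (B : 'M[A]_(k, m)) f g :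
  f =1 g -> minor B f = minor B g.
Proof. by move=> fg; congr (\det _); apply/matrixP => i j; rewrite !mxE fg. Qed.

Lemma minor_col_mx_multiindex (A : comNzRingType) (k m : nat) (u : 'rV[A]_m) (B : 'M[A]_(k, m))
  (K : multiindex (1 + k) m) :
  minor (col_mx u B) (val K) =
  \sum_j u 0 (val K j) * ((-1) ^+ j * minor B (val (drop_index K j))).
Proof.
rewrite minor_col_mx; apply: eq_bigr => j _; do 2 congr (_ * _).
by apply: minor_ext => i; rewrite /= ffunE.
Qed.

Lemma row_free_col_mx (F : fieldType) (k m : nat) (v : 'rV[F]_m) (B : 'M[F]_(k, m)) :
  row_free B -> ~ (exists u, v = u *m B) -> row_free (col_mx v B).
Proof.
move=> fB nv; rewrite -kermx_eq0; apply/rowV0P => u /sub_kermxP.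
rewrite -[u]hsubmxK mul_row_col [lsubmx u]mx11_scalar mul_scalar_mx.
set a := lsubmx u 0 0; have [->|a0] := eqVneq a 0.
  rewrite scale0r add0r => /eqP; rewrite mulmx_free_eq0 // => /eqP ->.
  by rewrite -scalemx1 scale0r row_mx0.
move/eqP; rewrite addr_eq0 => /eqP av; case: nv.
exists (- a^-1 *: rsubmx u); rewrite -scalemxAl scaleNr -scalerN -av.
by rewrite scalerA mulVf ?scale1r.
Qed.

(** The equations v /\ b_1 /\ .. /\ b_k = 0 of a subspace; by Laplace expansion
they only depend on the Pluecker coordinates. *)
Lemma mem_basis_minor (R : realType) (k m : nat) (V : {vspace 'rV[R]_m})
  (B : 'M[R]_(k, m)) (v : 'rV[R]_m) : basis_mx V B ->
  (v \in V) <-> forall K : multiindex (1 + k) m, minor (col_mx v B) (val K) = 0.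
Proof.
move=> BV; split => [/(mem_basis_mx _ BV)[u ->] K|K0].
  apply/eqP; rewrite /minor -[_ == 0]negbK -unitfE -[_ \is a _]unitmxE -row_free_unit.
  rewrite /row_free neq_ltn.
  have -> : col_mx (u *m B) B = col_mx u 1%:M *m B by rewrite mul_col_mx mul1mx.
  by rewrite -mulmx_colsub ltnS (leq_trans (mxrankM_maxl _ _)) // rank_leq_col.
apply/(mem_basis_mx _ BV); apply: contrapT => /(row_free_col_mx (basis_mx_row_free BV)).
by case/minor_neq0_multiindex => K; rewrite K0 eqxx.
Qed.

(** Proportional minors give the same equations [mem_basis_minor]. *)
Lemma eq_subspace_minor (R : realType) (k m : nat) (V1 V2 : {vspace 'rV[R]_m})
  (B1 B2 : 'M[R]_(k, m)) (c1 c2 : R) : basis_mx V1 B1 -> basis_mx V2 B2 ->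
  c1 != 0 -> c2 != 0 ->
  (forall I : multiindex k m, c1 * minor B1 (val I) = c2 * minor B2 (val I)) -> V1 = V2.
Proof.
move=> BV1 BV2 c10 c20 e.
have key v (K : multiindex (1 + k) m) : c1 * minor (col_mx v B1) (val K) = c2 * minor (col_mx v B2) (val K).
  rewrite !minor_col_mx_multiindex !mulr_sumr; apply: eq_bigr => j _.
  by rewrite !(mulrCA c1) !(mulrCA c2) e.
apply/vspaceP => v; apply/idP/idP.
  move=> /(mem_basis_minor _ BV1) v1; apply/(mem_basis_minor _ BV2) => K.
  by apply: (mulfI c20); rewrite -key v1 !mulr0.
move=> /(mem_basis_minor _ BV2) v2; apply/(mem_basis_minor _ BV1) => K.
by apply: (mulfI c10); rewrite key v2 !mulr0.
Qed.

(** Northcott property: the minors of an integer basis divided by their gcd are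
integers bounded by the height, and they determine the subspace. *)
Lemma finite_height_le (R : realType) (m k : nat) (N : R) :
  finite_set [set V : {vspace 'rV[R]_m} |
    [/\ rational_subspace V, \dim V = k & height V <= N]].
Proof.
set S := (X in finite_set X).
pose M := (Num.truncn N).+1.
pose T := {ffun multiindex k m -> 'I_(M + M).+1}.
have ex V : exists t : T, S V -> exists B : 'M[int]_(k, m), basis_mx V (intr_mx R B) /\
    forall I : multiindex k m, minor B (val I) = (minor_gcd B)%:Z * ((t I)%:Z - M%:Z).
  have [SV|nS] := pselect (S V); last by exists [ffun=> ord0] => /nS.
  have [/rational_subspace_int_basis[B BV] dk hV] := SV; subst k.
  have g0 := minor_gcd_gt0 (basis_mx_row_free BV).
  exists [ffun I : multiindex (\dim V) m => inord `|(minor B (val I) %/ (minor_gcd B)%:Z)%Z + M%:Z|] => _.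
  exists B; split => // I; rewrite ffunE.
  have := minor_gcd_le_height I BV.
  have : ((minor_gcd B)%:Z %| minor B (val I))%Z by rewrite /dvdz; exact: minor_gcd_dvd.
  move=> /divzK; set X := (_ %/ _)%Z => XE.
  rewrite -XE intrM normrM [X in _ * X]ger0_norm // ler_pM2r ?ltr0n // => XN.
  have XM : `|X| < M%:Z.
    rewrite -(ltr_int R) intr_norm (le_lt_trans XN) // (le_lt_trans hV) //.
    by rewrite /M -pmulrn; exact: truncnS_gt.
  rewrite inordK; last by lia.
  by rewrite [LHS]mulrC; congr (_ * _); lia.
have [f fP] := choice ex.
have : (f @` S #= S)%card.
  apply: inj_card_eq => V1 V2 /set_mem S1 /set_mem S2 e.
  have [B1 [BV1 E1]] := fP _ S1; have [B2 [BV2 E2]] := fP _ S2.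
  apply: (@eq_subspace_minor _ _ _ _ _ _ _ (minor_gcd B2)%:R (minor_gcd B1)%:R BV1 BV2).
  - by rewrite pnatr_eq0 -lt0n; apply: minor_gcd_gt0 (basis_mx_row_free BV2).
  - by rewrite pnatr_eq0 -lt0n; apply: minor_gcd_gt0 (basis_mx_row_free BV1).
  by move=> I; rewrite !minor_intr E1 E2 e !intrM -!pmulrn mulrCA.
by move/eq_finite_set <-; exact: finite_finset.
Qed.

(** * Projective distance *)

Lemma det_mx22 (A : comNzRingType) (M : 'M[A]_2) :
  \det M = M 0 0 * M 1 1 - M 0 1 * M 1 0.
Proof.
rewrite (expand_det_row _ 0) !big_ord_recl big_ord0 /cofactor !det_mx11 !mxE.
rewrite addr0 expr0 expr1 mul1r mulN1r mulrN.
congr (M _ _ * M _ _ - M _ _ * M _ _); exact: val_inj.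
Qed.

Lemma wedge2E (R : realType) (m : nat) (x y : 'rV[R]_m) (I : multiindex 2 m) :
  wedge [tuple x; y] I =
  x 0 (val I 0) * y 0 (val I 1) - x 0 (val I 1) * y 0 (val I 0).
Proof. by rewrite ffunE det_mx22 !mxE. Qed.

Lemma wedge2_ge (R : realType) (m : nat) (x y : 'rV[R]_m) i j :
  `|x 0 i * y 0 j - x 0 j * y 0 i| <= l2norm (wedge [tuple x; y]).
Proof.
wlog lt : i j / (i < j)%N => [wl|].
  case: (ltngtP i j) => [|/wl|/val_inj ->]; [exact: wl|by rewrite distrC|].
  by rewrite subrr normr0 l2norm_ge0.
have inc : increasing [ffun a : 'I_2 => if a == 0 then i else j].
  apply/forallP => a; apply/forallP => b; apply/implyP; rewrite !ffunE.
  by case: a b => [[|[|//]] ? ] [[|[|//]] ? ].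
pose I : multiindex 2 m := exist (fun g : {ffun _ -> _} => is_true (increasing g)) _ inc.
have := l2norm_ge (wedge [tuple x; y]) I.
by rewrite wedge2E /= !ffunE.
Qed.

Lemma wedge2_le (R : realType) (m : nat) (x y : 'rV[R]_m) (M : R) : 0 <= M ->
  (forall i j, `|x 0 i * y 0 j - x 0 j * y 0 i| <= M) ->
  l2norm (wedge [tuple x; y]) <= #|multiindex 2 m|%:R * M.
Proof. by move=> M0 xyM; apply: l2norm_le => // I; rewrite wedge2E. Qed.

Lemma l2norm_gt0 (R : realType) (m : nat) (y : 'rV[R]_m) : y != 0 -> 0 < l2norm (y 0).
Proof.
move=> y0; rewrite lt_neqAle l2norm_ge0 andbT eq_sym; apply: contra y0 => /eqP e.
apply/eqP/rowP => i; have := l2norm_ge (y 0) i; rewrite e normr_le0 mxE.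
by move/eqP.
Qed.

Lemma proj_dist_ge0 (R : realType) (m : nat) (x y : 'rV[R]_m) : 0 <= proj_dist x y.
Proof. by rewrite /proj_dist divr_ge0 ?mulr_ge0 ?l2norm_ge0. Qed.

Lemma proj_dist_sub_le (R : realType) (m : nat) (x y : 'rV[R]_m) (V : {vspace 'rV[R]_m}) :
  y \in V -> y != 0 -> proj_dist_sub x V <= proj_dist x y.
Proof.
move=> yV y0; apply: ge_inf; last by exists y.
by exists 0 => _ [z _ <-]; exact: proj_dist_ge0.
Qed.

Lemma proj_dist_sub_lb (R : realType) (m : nat) (x : 'rV[R]_m)
  (V : {vspace 'rV[R]_m}) (e : R) : (0 < \dim V)%N ->
  (forall y, y \in V -> y != 0 -> e <= proj_dist x y) -> e <= proj_dist_sub x V.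
Proof.
move=> dV He; apply: lb_le_inf; last by move=> _ [y [yV y0] <-]; exact: He.
by exists (proj_dist x (vpick V)), (vpick V) => //; split; [exact: memv_pick|rewrite vpick0 -dimv_eq0 -lt0n].
Qed.

Lemma proj_dist_sub_anti (R : realType) (m : nat) (x : 'rV[R]_m)
  (V W : {vspace 'rV[R]_m}) : (0 < \dim V)%N -> (V <= W)%VS ->
  proj_dist_sub x W <= proj_dist_sub x V.
Proof.
move=> dV VW; apply: proj_dist_sub_lb => // y yV y0.
by apply: proj_dist_sub_le => //; exact: subvP yV.
Qed.

Lemma proj_dist_sub_lt (R : realType) (m : nat) (x : 'rV[R]_m)
  (V : {vspace 'rV[R]_m}) (e : R) : (0 < \dim V)%N -> proj_dist_sub x V < e ->
  exists y, [/\ y \in V, y != 0 & proj_dist x y < e].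
Proof.
move=> dV /inf_lt[|_ [y [yV y0] <-] lt]; last by exists y.
by exists (proj_dist x (vpick V)), (vpick V) => //; split; [exact: memv_pick|rewrite vpick0 -dimv_eq0 -lt0n].
Qed.

(** The solution of a linear system with rational coefficients and more unknowns
than equations. *)
Lemma rational_subspace_equation (R : realType) (m : nat) (V : {vspace 'rV[R]_m}) :
  rational_subspace V -> (\dim V < m)%N ->
  exists a : 'I_m -> rat, (exists i, a i != 0) /\
    forall v, v \in V -> \sum_i ratr (a i) * v 0 i = 0.
Proof.
move=> /rational_subspace_int_basis[B BV] lt.
pose Bq : 'M[rat]_(\dim V, m) := intr_mx rat B.
have /rowV0Pn[a /sub_kermxP aB a0] : kermx Bq^T != 0.
  rewrite kermx_eq0 /row_free; apply/negP => /eqP e.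
  by have := rank_leq_col Bq^T; rewrite e leqNgt lt.
exists (a 0); split.
  apply: contrapT => H; move/negP: a0; apply; apply/eqP/rowP => i; rewrite mxE.
  by apply: contrapT => /eqP ai; apply: H; exists i.
have aB' : map_mx ratr a *m (intr_mx R B)^T = 0.
  apply/rowP => i; have := congr1 (@ratr R) (congr1 (fun M : 'rV_(\dim V) => M 0 i) aB).
  rewrite !mxE rmorph0 rmorph_sum => e; apply: etrans e; apply: eq_bigr => j _.
  by rewrite !mxE rmorphM /= ratr_int.
move=> v /(mem_basis_mx _ BV)[u ->].
have : map_mx ratr a *m (u *m intr_mx R B)^T = 0 by rewrite trmx_mul mulmxA aB' mul0mx.
move=> /matrixP/(_ 0 0); rewrite [X in _ = X -> _]mxE => e.
apply: etrans e; rewrite mxE; apply: eq_bigr => j _.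
by rewrite [in RHS]mxE; congr (_ * _); rewrite [RHS]mxE.
Qed.

(** V lies in a rational hyperplane a.y = 0, and a.x <> 0. For y in V the identity
(a.x) y_j = sum_i a_i (x_i y_j - x_j y_i) bounds |y| by a multiple of |x /\ y|. *)
Lemma proj_dist_sub_gt0 (R : realType) (m : nat) (x : 'rV[R]_m)
  (V : {vspace 'rV[R]_m}) : lin_indep_over_Q x -> rational_subspace V ->
  (0 < \dim V < m)%N -> 0 < proj_dist_sub x V.
Proof.
move=> xQ rV /andP[V0 Vm]; have [a [[i0 ai0] aV]] := rational_subspace_equation rV Vm.
pose s := \sum_i ratr (a i) * x 0 i.
have s0 : s != 0 by apply: contra ai0 => /eqP /xQ ->.
pose A := \sum_i `|ratr (a i) : R|.
have m0 : (0 : R) < m%:R by rewrite ltr0n; exact: leq_ltn_trans Vm.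
have A0 : 0 < A.
  rewrite /A (bigD1 i0) //= ltr_pwDl ?sumr_ge0 // normr_gt0.
  by rewrite fmorph_eq0.
have x0 : x != 0.
  apply: contra s0 => /eqP x0; rewrite /s big1 // => i _.
  by rewrite x0 mxE mulr0.
have lx := l2norm_gt0 x0.
apply: (@lt_le_trans _ _ (`|s| / (m%:R * A * l2norm (x 0)))).
  by rewrite divr_gt0 ?normr_gt0 // !mulr_gt0.
apply: proj_dist_sub_lb => // y yV y0; have ly := l2norm_gt0 y0.
rewrite /proj_dist ler_pdivrMr ?mulr_gt0 // mulrAC ler_pdivlMr ?mulr_gt0 //.
suff H : `|s| * l2norm (y 0) <= m%:R * A * l2norm (wedge [tuple x; y]).
  rewrite mulrA [leRHS]mulrA [leRHS]mulrC; rewrite mulrAC [leLHS]mulrC.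
  by rewrite ler_pM2l // [leRHS]mulrC.
rewrite -mulrA.
suff H j : `|s| * `|y 0 j| <= A * l2norm (wedge [tuple x; y]).
  rewrite -ler_pdivlMl ?normr_gt0 //.
  have := @l2norm_le _ _ (y 0) (`|s|^-1 * (A * l2norm (wedge [tuple x; y]))).
  rewrite card_ord (mulrCA m%:R); apply.
    by rewrite !mulr_ge0 ?invr_ge0 ?l2norm_ge0 // ltW.
  by move=> j; rewrite ler_pdivlMl ?normr_gt0.
rewrite -normrM /A [leRHS]mulr_suml.
have -> : s * y 0 j = \sum_i ratr (a i) * (x 0 i * y 0 j - x 0 j * y 0 i).
  under eq_bigr do rewrite mulrBr mulrA.
  rewrite sumrB -mulr_suml -/s [X in _ - X](_ : _ = 0) ?subr0 //.
  under eq_bigr do rewrite mulrCA.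
  by rewrite -mulr_sumr aV // mulr0.
apply: le_trans (ler_norm_sum _ _ _) _; apply: ler_sum => i _.
by rewrite normrM ler_wpM2l // wedge2_ge.
Qed.

(** For an integer point P the entries are the errors P_i - P_0 theta_i. *)
Definition defect (R : realType) (n : nat) (theta : 'rV[R]_n) (P : 'rV[R]_n.+1) :
  'rV[R]_n.+1 := P - P 0 ord0 *: hcoord theta.

Lemma hcoord0 (R : realType) (n : nat) (theta : 'rV[R]_n) : hcoord theta 0 ord0 = 1.
Proof.
rewrite mxE; case: splitP => [i _|i /= //]; by rewrite ord1 mxE.
Qed.

Lemma hcoord_lift (R : realType) (n : nat) (theta : 'rV[R]_n) i :
  hcoord theta 0 (lift ord0 i) = theta 0 i.
Proof.
rewrite mxE; case: splitP => [j|j] /=; first by rewrite ord1.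
by rewrite /bump !add1n => -[] e; congr (theta _ _); exact: val_inj.
Qed.

Lemma hcoord_neq0 (R : realType) (n : nat) (theta : 'rV[R]_n) : hcoord theta != 0.
Proof.
apply/eqP => /(congr1 (fun M : 'rV_n.+1 => M 0 ord0)); rewrite hcoord0 mxE.
by move/eqP; rewrite oner_eq0.
Qed.

Lemma defectE (R : realType) (n : nat) (theta : 'rV[R]_n) P j :
  defect theta P 0 j = P 0 j - P 0 ord0 * hcoord theta 0 j.
Proof. by rewrite !mxE. Qed.

(** The minors of (T, P) are those of (T, defect P), because the two second rows
differ by a multiple of T. *)
Lemma proj_dist_le (R : realType) (n : nat) (theta : 'rV[R]_n) (P : 'rV[R]_n.+1) (rho s : R) j :
  0 < s -> s <= `|P 0 j| -> (forall i, `|defect theta P 0 i| <= rho) ->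
  proj_dist (hcoord theta) P <= 2 * #|multiindex 2 n.+1|%:R * (rho / s).
Proof.
move=> s0 sP Pr; set T := hcoord theta; have lT := l2norm_gt0 (hcoord_neq0 theta).
have rho0 : 0 <= rho by exact: le_trans (Pr j).
rewrite /proj_dist; have lP : s <= l2norm (P 0) := le_trans sP (l2norm_ge _ _).
have lP0 : 0 < l2norm (P 0) by exact: lt_le_trans lP.
rewrite ler_pdivrMr ?mulr_gt0 //.
apply: (@le_trans _ _ (#|multiindex 2 n.+1|%:R * (2 * (l2norm (T 0) * rho)))).
  apply: wedge2_le => [|a b]; first by rewrite !mulr_ge0 // ltW.
  have -> : T 0 a * P 0 b - T 0 b * P 0 a = T 0 a * defect theta P 0 b - T 0 b * defect theta P 0 a.
    by rewrite !defectE -/T; ring.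
  apply: le_trans (ler_normB _ _) _; rewrite !normrM mulr_natl mulr2n.
  by apply: lerD; rewrite ler_pM // l2norm_ge.
rewrite -subr_ge0.
have -> : 2 * #|multiindex 2 n.+1|%:R * (rho / s) * (l2norm (T 0) * l2norm (P 0)) -
  #|multiindex 2 n.+1|%:R * (2 * (l2norm (T 0) * rho)) =
  2 * #|multiindex 2 n.+1|%:R * rho * l2norm (T 0) * ((l2norm (P 0) - s) / s).
  field; exact: lt0r_neq0.
by rewrite !mulr_ge0 ?subr_ge0 ?invr_ge0 // ltW.
Qed.

(** As T_0 = 1, the defect of P consists of minors of (T, P). *)
Lemma defect_le (R : realType) (n : nat) (theta : 'rV[R]_n) (P : 'rV[R]_n.+1) j : P != 0 ->
  `|defect theta P 0 j| <= proj_dist (hcoord theta) P * (l2norm (hcoord theta 0) * l2norm (P 0)).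
Proof.
move=> P0; rewrite /proj_dist divfK; last first.
  by rewrite mulf_neq0 // lt0r_neq0 // l2norm_gt0 // hcoord_neq0.
have := wedge2_ge (hcoord theta) P ord0 j; rewrite hcoord0 mul1r defectE.
by rewrite [_ * P 0 ord0]mulrC.
Qed.

(** * Short integer vectors modulo a rational subspace *)

Lemma card_box (k : nat) (a : 'I_k -> nat) :
  #|{: {dffun forall i : 'I_k, 'I_(a i)}}| = (\prod_i a i)%N.
Proof.
rewrite card_dep_ffun foldrE big_map big_enum /=.
by apply: eq_bigr => i _; rewrite card_ord.
Qed.

(** Cut the unit cube into b ^ #|L| boxes of side 1 / b. *)
Lemma pigeonhole_box (R : realType) (T L : finType) (q : T -> L -> R) (b : nat) :
  (forall t l, 0 <= q t l < 1) -> (0 < b)%N -> (b ^ #|L| < #|T|)%N ->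
  exists t u, t != u /\ forall l, `|q t l - q u l| <= b%:R^-1.
Proof.
case: b => // b q01 _ lt.
pose f t : {ffun L -> 'I_b.+1} := [ffun l => inord (Num.truncn (b.+1%:R * q t l))].
have bq0 t l : 0 <= b.+1%:R * q t l by rewrite mulr_ge0 //; case/andP: (q01 t l).
have [/injectiveP finj|/injectivePn[t [u tu ftu]]] := boolP (injectiveb f).
  by have := leq_card f finj; rewrite card_ffun card_ord leqNgt lt.
exists t, u; split => // l.
have := congr1 (fun g : {ffun L -> 'I_b.+1} => val (g l)) ftu.
have H v : (Num.truncn (b.+1%:R * q v l) < b.+1)%N.
  have /andP[_ q1] := q01 v l.
  by rewrite -(ltr_nat R) (le_lt_trans (y := b.+1%:R * q v l)) ?truncn_le // gtr_pMr.
rewrite /= !ffunE !inordK // => e.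
have /andP[t1 t2] := truncn_itv (bq0 t l).
have /andP[u1 u2] := truncn_itv (bq0 u l).
have b0 : (0 : R) < b.+1%:R by [].
rewrite -(ler_pM2l b0) divff ?lt0r_neq0 // -[X in X * _]ger0_norm // -normrM mulrBr.
rewrite ler_norml; move: t1 t2 u1 u2; rewrite e -!natr1 => *.
by apply/andP; split; lra.
Qed.

Lemma minor_neq0_row_free (F : fieldType) (k m : nat) (B : 'M[F]_(k, m)) f :
  minor B f != 0 -> row_free B.
Proof.
move=> d0; rewrite -kermx_eq0; apply/rowV0P => u /sub_kermxP uB.
have /eqP : u *m colsub f B = 0.
  by rewrite mulmx_colsub uB; apply/matrixP => i j; rewrite !mxE.
by rewrite mulmx_free_eq0 ?row_free_unit ?unitmxE ?unitfE // => /eqP.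
Qed.

Lemma intr_mxM (R : pzRingType) (k l m : nat) (A : 'M[int]_(k, l)) (B : 'M[int]_(l, m)) :
  intr_mx R (A *m B) = intr_mx R A *m intr_mx R B.
Proof. exact: map_mxM. Qed.

Lemma exists_min_nat (P : nat -> Prop) : (exists a, P a) ->
  exists2 a, P a & forall b, P b -> (a <= b)%N.
Proof.
move=> exP; have exb : exists a, `[< P a >] by case: exP => a Pa; exists a; apply/asboolP.
case: (ex_minnP exb) => a /asboolP Pa amin; exists a => // b Pb.
by apply: amin; apply/asboolP.
Qed.

(** Hermite normal form of the projection of V /\ Z^m to the columns f: the i-th
row is chosen with the smallest positive leading entry a_i. By minimality the
projection contains no nonzero vector with all entries smaller than the a_i, so
the points of the box prod_i [0, a_i) are pairwise incongruent modulo it. *)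
Lemma triangular_basis (R : realType) (k m : nat) (V : {vspace 'rV[R]_m})
  (B : 'M[int]_(k, m)) (f : 'I_k -> 'I_m) : basis_mx V (intr_mx R B) -> minor B f != 0 ->
  exists (b : 'M[int]_(k, m)) (a : 'I_k -> nat),
    [/\ basis_mx V (intr_mx R b), forall i, (0 < a i)%N,
        minor b f = (\prod_i a i)%N%:Z &
        forall z : 'rV[int]_m, intr_mx R z \in V ->
          (forall i, `|z 0 (f i)| < (a i)%:Z) -> forall i, z 0 (f i) = 0].
Proof.
move=> BV Bf.
pose P (i : 'I_k) (z : 'rV[int]_m) (a : nat) :=
  [/\ intr_mx R z \in V, forall j : 'I_k, (j < i)%N -> z 0 (f j) = 0,
      z 0 (f i) = a%:Z & (0 < a)%N].
have exP i : exists a, exists z, P i z a.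
  pose z := Num.sg (minor B f) *: row i (\adj (colsub f B) *m B).
  have zf j : z 0 (f j) = `|minor B f| * (j == i)%:R.
    have := mul_adj_mx (colsub f B); rewrite mulmx_colsub => /matrixP/(_ i j).
    rewrite /z !mxE => e; apply: etrans (congr1 (fun x => _ * x) e) _.
    by rewrite -/(minor B f) normrEsg !mulrnAr mulr1 [j == i]eq_sym.
  exists `|minor B f|%N, z; split.
  - apply/(mem_basis_mx _ BV).
    exists (intr_mx R (Num.sg (minor B f) *: row i (\adj (colsub f B)))).
    rewrite -intr_mxM; congr (intr_mx R _); rewrite /z -scalemxAl; congr (_ *: _).
    by rewrite row_mul.
  - by move=> j ji; rewrite zf [j == i]ltn_eqF ?mulr0.
  - by rewrite zf eqxx mulr1 abszE.
  - by rewrite absz_gt0.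
have /choice[a aP] : forall i, exists a, (exists z, P i z a) /\ forall b, (exists z, P i z b) -> (a <= b)%N.
  by move=> i; have [a ? ?] := exists_min_nat (exP i); exists a.
have /choice[z zP] : forall i, exists z, P i z (a i) by move=> i; case: (aP i).
have bf : minor (\matrix_i z i) f = (\prod_i a i)%N%:Z.
  rewrite /minor -det_tr det_trig.
    by rewrite (big_morph Posz PoszM (erefl _)); apply: eq_bigr => i _; rewrite !mxE; case: (zP i).
  by apply/is_trig_mxP => i j lt; rewrite !mxE; case: (zP j) => _ + _ _; apply.
exists (\matrix_i z i), a; split => //.
- apply: basis_mxP; first exact: dim_basis_mx BV.
    move=> i; suff -> : row i (intr_mx R (\matrix_i z i)) = intr_mx R (z i) by case: (zP i).
    by apply/rowP => j; rewrite !mxE.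
  apply: (@minor_neq0_row_free _ _ _ _ f); rewrite minor_intr bf intr_eq0.
  rewrite eqz_nat -lt0n prodn_gt0 // => i; by case: (zP i).
- by move=> i; case: (zP i).
move=> w wV wa.
suff H : forall i : 'I_k, (forall j : 'I_k, (j < i)%N -> w 0 (f j) = 0) -> w 0 (f i) = 0.
  move=> i; move: (leqnn i.+1); move: {2}i.+1 => s; elim: s i => // s IH i lt.
  by apply: H => j ji; apply: IH; exact: leq_trans ji lt.
move=> i wj; apply: contrapT => /eqP wi.
suff h : (a i <= absz (w 0%R (f i)))%N.
  by have := wa i; rewrite -abszE ltz_nat ltnNge h.
apply: (aP i).2.
exists (Num.sg (w 0 (f i)) *: w); split.
- have -> : intr_mx R (Num.sg (w 0 (f i)) *: w) = (Num.sg (w 0 (f i)))%:~R *: intr_mx R w.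
    by apply/rowP => j; rewrite !mxE intrM.
  by rewrite memvZ.
- by move=> j ji; rewrite mxE (wj _ ji) ?mulr0.
- by rewrite mxE abszE normrEsg.
- by rewrite absz_gt0.
Qed.

Lemma int_basis_rational (R : realType) (k m : nat) (V : {vspace 'rV[R]_m})
  (B : 'M[int]_(k, m)) : basis_mx V (intr_mx R B) -> rational_subspace V.
Proof.
move=> BV; exists (rows (intr_mx rat B)); rewrite -(span_basis BV); congr <<_>>%VS.
rewrite /= -map_comp; apply: eq_map => i /=.
by apply/rowP => j; rewrite !mxE ratr_int.
Qed.

Lemma minor_submx (R : realType) (k m : nat) (V : {vspace 'rV[R]_m}) (B : 'M[R]_(k, m))
  (u v : 'rV[R]_m) (K : multiindex (1 + k) m) : basis_mx V B -> u \in V ->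
  minor (col_mx (u - v) B) (val K) = - minor (col_mx v B) (val K).
Proof.
move=> BV uV; have := (mem_basis_minor u BV).1 uV K.
rewrite !minor_col_mx_multiindex => u0; apply/eqP; rewrite -addr_eq0 -big_split /=.
rewrite -[X in _ == X]u0; apply/eqP/eq_bigr => j _.
by rewrite !mxE -mulrDl subrK.
Qed.

Lemma card_codomC (k m : nat) (f : 'I_k -> 'I_m) : injective f ->
  #|{: {j : 'I_m | j \notin codom f}}| = (m - k)%N.
Proof.
move=> finj; rewrite card_sig.
have := cardC (mem (codom f)); rewrite card_codom // !card_ord => e.
by apply: etrans (congr1 (subn^~ k) e); rewrite /= addKn; apply: eq_card.
Qed.

(** Minkowski's theorem for the quotient of Z^m by V, by the pigeonhole principle.
Let w(u) be the point of V whose coordinates on the columns f are a given integer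
point u of the box prod_i [0, a_i). Among the prod_i a_i points w(u), two have
fractional parts that differ by at most 1 / N; subtracting the integer parts of
these two gives z, and the difference q of the fractional parts is a representative
of z modulo V. Finally z is not in V because its coordinates on f are the
difference of two distinct points of the box. *)
Lemma small_vector_mod_subspace (R : realType) (k m : nat) (V : {vspace 'rV[R]_m})
  (b : 'M[int]_(k, m)) (a : 'I_k -> nat) (f : 'I_k -> 'I_m) (N : nat) :
  injective f -> basis_mx V (intr_mx R b) -> minor b f != 0 ->
  (forall z : 'rV[int]_m, intr_mx R z \in V ->
     (forall i, `|z 0 (f i)| < (a i)%:Z) -> forall i, z 0 (f i) = 0) ->
  (0 < N)%N -> (N ^ (m - k) < \prod_i a i)%N ->
  exists (z : 'rV[int]_m) (w q : 'rV[R]_m),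
    [/\ intr_mx R z \notin V, w \in V, intr_mx R z = w - q &
        forall j, `|q 0 j| <= N%:R^-1].
Proof.
move=> finj bV bf amin N0 Na.
set bR := intr_mx R b in bV.
have bRf : colsub f bR \in unitmx.
  by rewrite unitmxE unitfE -/(minor bR f) minor_intr intr_eq0.
pose T : finType := {dffun forall i : 'I_k, 'I_(a i)}.
pose L : finType := {j : 'I_m | j \notin codom f}.
pose w (u : T) : 'rV[R]_m := (\row_i (u i)%:R) *m invmx (colsub f bR) *m bR.
have wV u : w u \in V by apply/(mem_basis_mx _ bV); eexists.
have wf u i : w u 0 (f i) = (u i)%:R.
  have : colsub f (w u) = \row_i (u i)%:R by rewrite /w -mulmx_colsub mulmxKV.
  by move/rowP/(_ i); rewrite !mxE.
pose q (u : T) (l : L) := w u 0 (val l) - (Num.floor (w u 0 (val l)))%:~R.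
have q01 u l : 0 <= q u l < 1.
  have /andP[h1 h2] := floor_itv (w u 0 (val l)).
  by move: h2; rewrite /q subr_ge0 h1 intrD /= => h2; rewrite ltrBlDl.
have [|t [u [tu qtu]]] := pigeonhole_box q01 N0.
  by rewrite card_codomC // card_box.
pose z (u : T) : 'rV[int]_m := \row_j Num.floor (w u 0 j).
have zf v i : z v 0 (f i) = (v i)%:Z by rewrite mxE wf pmulrn intrKfloor.
exists (z t - z u), (w t - w u), ((w t - w u) - intr_mx R (z t - z u)).
have zB j : (z t - z u) 0 j = z t 0 j - z u 0 j by rewrite !mxE.
have NV : (0 : R) <= N%:R^-1 by rewrite invr_ge0.
split.
- apply/negP => zV.
  have za i : `|(z t - z u) 0 (f i)| < (a i)%:Z.
    rewrite zB !zf.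
    have := ltn_ord (t i); have := ltn_ord (u i); lia.
  have := amin _ zV za => e; move/negP: tu; apply; apply/eqP/ffunP => i; apply: val_inj.
  by have /eqP := e i; rewrite zB !zf subr_eq0 => /eqP [].
- exact: memvB.
- by rewrite subKr.
move=> j.
have -> : (w t - w u - intr_mx R (z t - z u)) 0 j =
   (w t 0 j - (z t 0 j)%:~R) - (w u 0 j - (z u 0 j)%:~R).
  by rewrite !mxE intrB; ring.
have [/codomP[i ->]|jf] := boolP (j \in codom f).
  by rewrite !wf !zf -!pmulrn !subrr normr0.
by have := qtu (Sub j jf); rewrite /q /= !mxE.
Qed.

Lemma rational_extension (R : realType) (k m : nat) (V : {vspace 'rV[R]_m})
  (b : 'M[int]_(k, m)) (z : 'rV[int]_m) : basis_mx V (intr_mx R b) -> intr_mx R z \notin V ->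
  exists W : {vspace 'rV[R]_m}, (V <= W)%VS /\ basis_mx W (intr_mx R (col_mx z b)).
Proof.
move=> bV zV; exists <<rows (intr_mx R (col_mx z b))>>%VS.
have bW : basis_mx <<rows (intr_mx R (col_mx z b))>> (intr_mx R (col_mx z b)).
  apply: row_free_basis_mx; rewrite /intr_mx map_col_mx; apply: row_free_col_mx.
    exact: basis_mx_row_free bV.
  by move/(mem_basis_mx _ bV) => h; rewrite h in zV.
split => //; apply/subvP => v /(mem_basis_mx _ bV)[u ->].
apply/(mem_basis_mx _ bW); exists (row_mx 0 u).
by rewrite /intr_mx map_col_mx mul_row_col mul0mx add0r.
Qed.

Lemma dvdn_minor_col_mx (k m : nat) (b : 'M[int]_(k, m)) (z : 'rV[int]_m)
  (K : multiindex (1 + k) m) : (minor_gcd b %| `|minor (col_mx z b) (val K)|)%N.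
Proof.
rewrite minor_col_mx_multiindex.
suff : ((minor_gcd b)%:Z %| \sum_j z 0 (val K j) * ((-1) ^+ j * minor b (val (drop_index K j))))%Z.
  by [].
apply: rpred_sum => j _; rewrite mulrA; apply: dvdz_mull.
exact: minor_gcd_dvd.
Qed.

(** With D the largest minor of the triangular basis b and g the gcd of its minors,
H(V) is D / g up to constants. The vector z of [small_vector_mod_subspace] at
distance 1 / N from V, with N of order (D / g)^(1/r) for r = m - k, enlarges V to
a W of which the minors are << D / N and still divisible by g. The lower bound on
H(V) ensures N >= 1. *)
Lemma going_up (R : realType) (k m : nat) : (k < m)%N -> exists C : R, 0 < C /\
  forall V : {vspace 'rV[R]_m}, rational_subspace V -> \dim V = k ->
    C <= height V ->
    exists W : {vspace 'rV[R]_m}, [/\ rational_subspace W, \dim W = k.+1, (V <= W)%VS &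
      height W <= C * height V `^ (1 - (m - k)%:R^-1)].
Proof.
move=> km; pose c1 : R := #|multiindex k m|%:R; pose c2 : R := #|multiindex (1 + k) m|%:R.
pose C := 2 * c1 + 4 * c2 * (k.+1)%:R + 1.
have c10 : 0 <= c1 by []. have c20 : 0 <= c2 by [].
have r0 : (0 < m - k)%N by rewrite subn_gt0.
set r : nat := (m - k)%N in r0 *.
have C0 : 0 < C by rewrite ltr_pwDr // addr_ge0 // !mulr_ge0.
exists C; split => // V rV dV HC.
have [B BV] := rational_subspace_int_basis rV; move: B BV; rewrite dV => B BV.
have /minor_neq0_multiindex[I0] := basis_mx_row_free BV.
rewrite minor_intr intr_eq0 => BI0.
(* minors of any two bases of V are proportional, so I is also maximal for b *)
pose I := [arg max_(J > I0) `|minor B (val J)|%N].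
have Imax (J : multiindex k m) : (`|minor B (val J)| <= `|minor B (val I)|)%N.
  by rewrite /I; case: arg_maxnP => // K _; apply.
have BI : minor B (val I) != 0.
  by rewrite -absz_gt0 (leq_trans _ (Imax I0)) // absz_gt0.
have [b [a [bV a0 bI amin]]] := triangular_basis BV BI.
set D := (\prod_i a i)%N in bI.
have D0 : (0 < D)%N by rewrite prodn_gt0.
have D0' : (0 : R) < D%:R by rewrite ltr0n.
have bmax (J : multiindex k m) : `|(minor b (val J))%:~R : R| <= D%:R.
  have [S S0 bS] := basis_mx_change BV bV.
  have e (K : multiindex k m) : (minor b (val K))%:~R = \det S * (minor B (val K))%:~R :> R.
    by rewrite -!minor_intr bS minor_mul.
  have -> : D%:R = `|(minor b (val I))%:~R : R| by rewrite bI -pmulrn ger0_norm.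
  rewrite !e !normrM ler_wpM2l // -!intr_norm ler_int.
  by rewrite -!abszE lez_nat.
pose g := minor_gcd b.
have g0 : (0 < g)%N by apply: minor_gcd_gt0 (basis_mx_row_free bV).
have g0' : (0 : R) < g%:R by rewrite ltr0n.
have HgD : height V * g%:R <= c1 * D%:R.
  by rewrite (height_basis bV); apply: l2norm_le.
have DHg : D%:R <= height V * g%:R.
  by have := minor_gcd_le_height I bV; rewrite bI -pmulrn ger0_norm.
pose M : R := D%:R / g%:R.
have MH : M <= height V by rewrite /M ler_pdivrMr.
have HM : height V <= c1 * M by rewrite /M mulrA ler_pdivlMr.
have M0 : 0 < M by rewrite divr_gt0.
have c1p : 0 < c1.
  rewrite lt_neqAle c10 andbT; apply/negP => /eqP e.
  by move: HM; rewrite -e mul0r; apply/negP; rewrite -ltNge (lt_le_trans C0).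
have M2 : 2 <= M.
  rewrite -(ler_pM2l c1p) (le_trans _ HM) // (le_trans _ HC) //.
  by rewrite /C mulrC -addrA lerDl addr_ge0 // !mulr_ge0.
have MD : M <= D%:R by rewrite /M ler_pdivrMr // ler_peMr // ler1n.
(* halving M makes the inequality N ^ r < D of the pigeonhole strict *)
pose y := (M / 2) `^ r%:R^-1.
have M20 : 0 < M / 2 by rewrite divr_gt0.
have rR : (r%:R : R) != 0 by rewrite pnatr_eq0 -lt0n.
have yr : y ^+ r = M / 2.
  by rewrite -powR_mulrn ?powR_ge0 // /y -powRrM mulVf // powRr1 // ltW.
have y0 : 0 <= y by exact: powR_ge0.
have y1 : 1 <= y.
  rewrite leNgt; apply/negP => lt.
  have : y ^+ r < 1 by rewrite exprn_ilt1 // -lt0n.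
  by rewrite yr ltNge ler_pdivlMr // mul1r M2.
pose N := Num.truncn y.
have /andP[N1 N2] : N%:R <= y < N.+1%:R := truncn_itv y0.
have N0 : (0 < N)%N by rewrite /N truncn_ge_nat.
have Ny : y <= 2 * N%:R.
  rewrite (le_trans (ltW N2)) // -natr1 mulr_natl mulr2n lerD2l.
  by rewrite ler1n.
have NrD : (N ^ r < D)%N.
  rewrite -(ltr_nat R) natrX (le_lt_trans (y := y ^+ r)) //.
    by rewrite lerXn2r ?nnegrE.
  by rewrite yr (lt_le_trans _ MD) // ltr_pdivrMr // ltr_pMr // ltr1n.
have bI0 : minor b (val I) != 0 by rewrite bI eqz_nat -lt0n.
have [z [w [q [zV wV zE qN]]]] :=
  small_vector_mod_subspace (@multiindex_inj _ _ I) bV bI0 amin N0 NrD.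
have [W [VW WB]] := rational_extension bV zV.
exists W; split => //; [exact: int_basis_rational WB|exact: dim_basis_mx WB|].
have NR0 : (0 : R) < N%:R by rewrite ltr0n.
have zb (K : multiindex (1 + k) m) : `|(minor (col_mx z b) (val K))%:~R : R| <= k.+1%:R * (D%:R / N%:R).
  rewrite -minor_intr /intr_mx map_col_mx -/(intr_mx R b) -/(intr_mx R z) zE.
  rewrite (minor_submx _ _ bV wV) normrN minor_col_mx_multiindex.
  apply: le_trans (ler_norm_sum _ _ _) _.
  apply: (@le_trans _ _ (\sum_(j < 1 + k) D%:R / N%:R)); last first.
    by rewrite sumr_const card_ord [leRHS]mulr_natl; exact: lexx.
  apply: ler_sum => j _; rewrite normrM [leRHS]mulrC ler_pM //.
  by rewrite normrM normrX normrN1 expr1n mul1r minor_intr.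
have := @height_le R _ _ W _ g WB (dvdn_minor_col_mx b z).
move/le_trans => /(_ _ (l2norm_le _ zb)) => hW.
have {hW} : height W * g%:R <= c2 * (k.+1%:R * (D%:R / N%:R)).
  by apply: hW; rewrite mulr_ge0 // divr_ge0.
have -> : c2 * (k.+1%:R * (D%:R / N%:R)) = (c2 * k.+1%:R * (M / N%:R)) * g%:R.
  rewrite /M; field; by rewrite !lt0r_neq0.
rewrite ler_pM2r // => /le_trans; apply.
have yM : M / N%:R <= 4 * (M / 2) `^ (1 - r%:R^-1).
  rewrite powRD; last by rewrite (lt0r_neq0 M20) implybT.
  rewrite (powRr1 (ltW M20)) powRN -/y.
  have y00 : 0 < y by exact: lt_le_trans y1.
  rewrite ler_pdivrMr // mulrAC -mulrA mulrA.
  rewrite [leRHS](_ : _ = M * (2 * N%:R / y)); last by field; exact: lt0r_neq0.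
  by rewrite ler_pMr // ler_pdivlMr // mul1r.
have e0 : 0 <= 1 - r%:R^-1 :> R by rewrite subr_ge0 invf_le1 ?ltr0n // ler1n.
have MH2 : (M / 2) `^ (1 - r%:R^-1) <= height V `^ (1 - r%:R^-1).
  apply: ge0_ler_powR; rewrite ?nnegrE ?(ltW M20) //; first exact: le_trans (ltW M0) MH.
  by rewrite (le_trans _ MH) // ler_pdivrMr // ler_peMr ?ler1n // ltW.
apply: (@le_trans _ _ (c2 * k.+1%:R * (4 * height V `^ (1 - r%:R^-1)))).
  by rewrite ler_wpM2l ?mulr_ge0 // (le_trans yM) // ler_wpM2l.
rewrite mulrA ler_wpM2r ?powR_ge0 // /C -subr_ge0.
by rewrite (_ : _ - _ = 2 * c1 + 1) ?addr_ge0 ?mulr_ge0 //; ring.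
Qed.

(** * Exponents of approximation by rational subspaces *)

Lemma powR_eventually_ge (R : realType) (C e : R) : 0 < e ->
  exists H0 : R, 1 <= H0 /\ forall H, H0 <= H -> C <= H `^ e.
Proof.
move=> e0; exists (Num.max 1 (`|C| `^ e^-1)); split; first by rewrite le_max lexx.
move=> H; rewrite ge_max => /andP[H1 HC].
apply: le_trans (ler_norm C) _.
have -> : `|C| = (`|C| `^ e^-1) `^ e by rewrite -powRrM mulVf ?lt0r_neq0 // powRr1.
by apply: ge0_ler_powR; rewrite ?nnegrE ?powR_ge0 ?(ltW e0) // (le_trans ler01).
Qed.

Lemma powRN_eventually_lt (R : realType) (eps e : R) : 0 < eps -> 0 < e ->
  exists H0 : R, 1 <= H0 /\ forall H, H0 <= H -> H `^ (- e) < eps.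
Proof.
move=> eps0 e0; have [H0 [H1 HH]] := powR_eventually_ge (2 / eps) e0.
exists H0; split => // H /[dup] /HH HC H0H.
have Hp : 0 < H `^ e by rewrite powR_gt0 // (lt_le_trans ltr01) // (le_trans H1).
rewrite powRN -ltf_pV2 ?posrE ?invr_gt0 // invrK (lt_le_trans _ HC) //.
by rewrite ltr_pMl ?invr_gt0 // ltr1n.
Qed.

Lemma finite_pos_lb (R : realType) (T : choiceType) (F : set T) (f : T -> R) :
  finite_set F -> (forall x, F x -> 0 < f x) ->
  exists2 e, 0 < e & forall x, F x -> e <= f x.
Proof.
move=> /finite_seqP[s ->] {F}; elim: s => [|a s IH] fs; first by exists 1.
have [|e e0 es] := IH; first by move=> x xs; apply: fs; rewrite /= inE xs orbT.
have fa : 0 < f a by apply: fs; rewrite /= inE eqxx.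
exists (Num.min e (f a)); first by rewrite lt_min e0.
move=> x /=; rewrite inE ge_min => /orP[/eqP->|/es ->//]; by rewrite lexx orbT.
Qed.

Definition omega_set (R : realType) (n d : nat) (theta : 'rV[R]_n) (w : R) :
  set {vspace 'rV[R]_n.+1} := [set V | [/\ rational_subspace V, \dim V = d.+1 &
          proj_dist_sub (hcoord theta) V <= height V `^ (- 1 - w)]].

(** The constant C is absorbed by a loss e in the exponent once the height is
large. Only finitely many V are excluded in this way, and if the remaining ones
were finite in number, all these distances, being positive, would have a positive
lower bound, whereas they are arbitrarily small. *)
Lemma omega_ge (R : realType) (n d : nat) (theta : 'rV[R]_n) (w C : R) :
  lin_indep_over_Q (hcoord theta) -> (d < n)%N ->
  (forall e, 0 < e -> exists V : {vspace 'rV[R]_n.+1},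
     [/\ rational_subspace V, \dim V = d.+1,
         proj_dist_sub (hcoord theta) V < e &
         proj_dist_sub (hcoord theta) V <= C * height V `^ (- 1 - w)]) ->
  (w%:E <= omega d theta)%E.
Proof.
(* an exponent w - e smaller than w leaves room for C <= H ^ e *)
move=> tQ dn HV; apply/lee_subgt0Pr => e e0.
apply: ereal_sup_ubound; exists (w - e) => //= fS.
have [H0 [H01 HH]] := powR_eventually_ge C e0.
have fF := finite_height_le (R := R) n.+1 d.+1 H0.
have fSF := conj fS fF; rewrite -finite_setU in fSF.
have [|eps eps0 epsF] := finite_pos_lb (f := proj_dist_sub (hcoord theta)) fSF.
  by move=> V [[rV dV _]|[rV dV _]]; apply: proj_dist_sub_gt0 => //; rewrite dV ltnS.
have [V [rV dV Veps VC]] := HV _ eps0.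
have hV := height_ge1 rV.
suff /epsF : (omega_set d theta (w - e) `|` [set V | [/\ rational_subspace V, \dim V = d.+1 &
    height V <= H0]]) V by rewrite leNgt Veps.
have [VH|VH] := leP (height V) H0; [by right|left; split => //].
apply: le_trans VC _.
have -> : - 1 - (w - e) = e + (- 1 - w) by ring.
rewrite [leRHS]powRD; last by rewrite lt0r_neq0 ?implybT // (lt_le_trans ltr01).
by rewrite ler_wpM2r ?powR_ge0 // HH // ltW.
Qed.

Lemma omega_set_large (R : realType) (n d : nat) (theta : 'rV[R]_n) (w H0 : R) :
  infinite_set (omega_set d theta w) -> exists2 V, omega_set d theta w V & H0 < height V.
Proof.
move=> inf; apply: contrapT => nV; apply: inf.
apply: sub_finite_set (finite_height_le (R := R) n.+1 d.+1 H0) => V [rV dV Vw]; split => //.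
by rewrite leNgt; apply/negP => VH; apply: nV; exists V.
Qed.

(** The subspace W of [going_up] has d(T, W) <= d(T, V) <= H(V)^(-1-w) and
H(V) >> H(W)^(r/(r-1)), and (1 + w) r / (r - 1) is 1 plus the exponent below. *)
Lemma omega_going_up (R : realType) (n d : nat) (theta : 'rV[R]_n) (w : R) :
  lin_indep_over_Q (hcoord theta) -> (d.+1 < n)%N -> 0 < w ->
  infinite_set (omega_set d theta w) ->
  ((((n - d)%:R * w + 1) / (n - d - 1)%:R)%:E <= omega d.+1 theta)%E.
Proof.
move=> tQ dn w0 inf.
have dn1 : (d.+1 < n.+1)%N by apply: ltn_trans dn _.
have [C [C0 HC]] := @going_up R d.+1 n.+1 dn1.
rewrite subSS in HC; set r := (n - d)%N in HC *.
have r2 : (2 <= r)%N by rewrite /r; lia.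
set w' := (X in (X%:E <= _)%E).
(* w' is the exponent for which the power of H(W) below matches that of H(V) *)
have w'E : (1 - r%:R^-1) * (1 + w') = 1 + w.
  have r1 : (1 : R) < r%:R by rewrite ltr1n.
  have rB : (r - 1)%:R = r%:R - 1 :> R by rewrite natrB // ltnW.
  rewrite /w' -/r rB.
  move: (r%:R : R) r1 => x x1.
  have x0 : x != 0 by rewrite gt_eqF // (lt_trans ltr01).
  by field; rewrite x0 /= subr_eq0 gt_eqF.
have w'0 : 0 <= 1 + w'.
  by rewrite /w' addr_ge0 // divr_ge0 // addr_ge0 // mulr_ge0 // ltW.
apply: (@omega_ge _ _ _ _ _ (C `^ (1 + w'))) => // e e0.
have w10 : 0 < 1 + w by rewrite addr_gt0.
have [H0 [H01 HH]] := powRN_eventually_lt e0 w10.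
have [V [rV dV Vw] VH] := omega_set_large (Num.max C H0) inf.
move: VH; rewrite gt_max => /andP[CV H0V].
have [W [rW dW VW WH]] := HC V rV dV (ltW CV).
have hV := height_ge1 rV; have hW := height_ge1 rW.
have hV0 : 0 <= height V := le_trans ler01 hV.
have hW0 : 0 <= height W := le_trans ler01 hW.
have dWV : proj_dist_sub (hcoord theta) W <= height V `^ (- (1 + w)).
  rewrite opprD; apply: le_trans Vw; apply: proj_dist_sub_anti => //.
  by rewrite dV.
exists W; split; [exact: rW|exact: dW| |].
  by apply: le_lt_trans dWV _; apply: HH; exact: ltW.
apply: (le_trans dWV); rewrite -opprD !powRN.
have hWp : 0 < height W `^ (1 + w') by rewrite powR_gt0 // (lt_le_trans ltr01).
have hVp : 0 < height V `^ (1 + w) by rewrite powR_gt0 // (lt_le_trans ltr01).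
rewrite (ler_pdivlMr _ _ hWp) mulrC (ler_pdivrMr _ _ hVp).
rewrite -w'E powRrM -powRM ?powR_ge0 // ?(ltW C0) //.
apply: ge0_ler_powR; rewrite ?nnegrE ?mulr_ge0 ?powR_ge0 // ltW //.
Qed.

(** * Uniform approximation by rational points *)

Definition omega_hat0_set (R : realType) (n : nat) (theta : 'rV[R]_n) : set R :=
  [set w : R | \forall X \near +oo, exists x : 'rV[int]_n.+1,
      [/\ x != 0, forall i : 'I_n.+1, `|(x 0 i)%:~R| <= X &
          forall i : 'I_n, `|(x 0 ord0)%:~R * theta 0 i - (x 0 (lift ord0 i))%:~R|
              <= X `^ (- w)]].

Lemma defect_lift (R : realType) (n : nat) (theta : 'rV[R]_n) P (i : 'I_n) :
  defect theta P 0 (lift ord0 i) = P 0 (lift ord0 i) - P 0 ord0 * theta 0 i.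
Proof. by rewrite defectE hcoord_lift. Qed.

Lemma defect_ord0 (R : realType) (n : nat) (theta : 'rV[R]_n) P : defect theta P 0 ord0 = 0.
Proof. by rewrite defectE hcoord0 mulr1 subrr. Qed.

Lemma omega_hat0_set_defect (R : realType) (n : nat) (theta : 'rV[R]_n) (w : R) :
  omega_hat0_set theta w -> exists M : R, forall X, M < X -> exists x : 'rV[int]_n.+1,
    [/\ x != 0, forall i, `|intr_mx R x 0 i| <= X &
        forall j, `|defect theta (intr_mx R x) 0 j| <= X `^ (- w)].
Proof.
move=> [M [_ HM]]; exists M => X /HM[x [x0 xX xw]]; exists x; split => // [i|j].
  by rewrite mxE.
case: (unliftP ord0 j) => [i ->|->]; last by rewrite defect_ord0 normr0 powR_ge0.
by rewrite defect_lift distrC !mxE.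
Qed.

Lemma omega_hat0_set_le (R : realType) (n : nat) (theta : 'rV[R]_n) (w w' : R) :
  w' <= w -> omega_hat0_set theta w -> omega_hat0_set theta w'.
Proof.
move=> ww [M [_ HM]]; exists (Num.max M 1); split; first exact: num_real.
move=> X; rewrite gt_max => /andP[/HM[x [x0 xX xw]] X1]; exists x; split => // i.
by rewrite (le_trans (xw i)) // ler_powR ?lerN2 // ltW.
Qed.

Lemma abs_natB_le (a b K : nat) : (a < K.+1)%N -> (b < K.+1)%N -> `|a%:Z - b%:Z| <= K%:Z.
Proof. lia. Qed.

(** Pigeonhole on the multiples t * theta for t <= N^n, where N is close to
X^(1/(2n)). The exponent 1/(4n) obtained here is far from the optimal 1/n, but
only its positivity matters; the margin absorbs all constants. *)
Lemma dirichlet (R : realType) (n : nat) (theta : 'rV[R]_n) : (0 < n)%N ->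
  exists2 w : R, 0 < w & omega_hat0_set theta w.
Proof.
move=> n0; have nR : (0 : R) < n%:R by rewrite ltr0n.
pose e : R := (2 * n%:R)^-1; have e0 : 0 < e by rewrite invr_gt0 mulr_gt0.
pose A : R := 2 + \sum_i `|theta 0 i|.
have A2 : 2 <= A by rewrite lerDl sumr_ge0.
have thA i : `|theta 0 i| + 1 <= A.
  rewrite /A (bigD1 i) //= addrA.
  have : 0 <= \sum_(j | j != i) `|theta 0 j| by rewrite sumr_ge0.
  lra.
exists (e / 2); first by rewrite divr_gt0.
have [M1 [M11 HM1]] := powR_eventually_ge 2 (divr_gt0 e0 (ltr0Sn R 1)).
have [M2 [M21 HM2]] := powR_eventually_ge A (divr_gt0 ltr01 (ltr0Sn R 1)).
exists (Num.max M1 M2); split; first exact: num_real.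
move=> X; rewrite gt_max => /andP[/ltW XM1 /ltW XM2].
have X1 : 1 <= X by exact: le_trans XM1.
have X0 : 0 < X by exact: lt_le_trans X1.
have hX2 := HM1 _ XM1; have hXA := HM2 _ XM2.
pose y := X `^ e.
have y0 : 0 <= y by exact: powR_ge0.
have yE : y = X `^ (e / 2) * X `^ (e / 2).
  by rewrite -powRD ?(lt0r_neq0 X0) ?implybT //; congr (_ `^ _); field.
have y1 : 1 <= y by rewrite yE mulr_ege1 // (le_trans _ hX2) // ler1n.
pose N := Num.truncn y.
have /andP[N1 N2] : N%:R <= y < N.+1%:R := truncn_itv y0.
have N0 : (0 < N)%N by rewrite /N truncn_ge_nat.
have NR : (0 : R) < N%:R by rewrite ltr0n.
have Ny : y <= 2 * N%:R.
  by rewrite (le_trans (ltW N2)) // -natr1 mulr_natl mulr2n lerD2l ler1n.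
have NnX : (N ^ n)%:R <= X `^ (1 / 2).
  rewrite natrX (le_trans (y := y ^+ n)) ?lerXn2r ?nnegrE //.
  rewrite -powR_mulrn // /y -powRrM (_ : e * n%:R = 1 / 2) //.
  rewrite /e; field; exact: lt0r_neq0.
pose q (t : 'I_(N ^ n).+1) (i : 'I_n) : R := t%:R * theta 0 i - (Num.floor (t%:R * theta 0 i))%:~R.
have q01 t i : 0 <= q t i < 1.
  have /andP[h1 h2] := floor_itv (t%:R * theta 0 i).
  by move: h2; rewrite /q subr_ge0 h1 intrD /= => h2; rewrite ltrBlDl.
have [|t [u [tu qtu]]] := pigeonhole_box q01 N0; first by rewrite !card_ord.
pose x : 'rV[int]_n.+1 := \row_j if unlift ord0 j is Some i then
  Num.floor (t%:R * theta 0 i) - Num.floor (u%:R * theta 0 i) else t%:Z - u%:Z.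
have x0E : x 0 ord0 = t%:Z - u%:Z by rewrite mxE unlift_none.
have xlE i : x 0 (lift ord0 i) = Num.floor (t%:R * theta 0 i) - Num.floor (u%:R * theta 0 i).
  by rewrite mxE liftK.
have xq i : (x 0 ord0)%:~R * theta 0 i - (x 0 (lift ord0 i))%:~R = q t i - q u i.
  by rewrite x0E xlE !intrB -!pmulrn /q; ring.
have Nw : N%:R^-1 <= X `^ (- (e / 2)).
  rewrite powRN lef_pV2 ?posrE ?powR_gt0 //.
  have : 2 * X `^ (e / 2) <= y by rewrite yE ler_wpM2r ?powR_ge0.
  by move=> h; rewrite -(ler_pM2l (ltr0Sn R 1)) (le_trans h).
have x0N : `|(x 0 ord0)%:~R : R| <= X `^ (1 / 2).
  apply: le_trans NnX; rewrite x0E -intr_norm pmulrn ler_int.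
  exact: abs_natB_le (ltn_ord t) (ltn_ord u).
have XX : X = X `^ (1 / 2) * X `^ (1 / 2).
  by rewrite -powRD ?(lt0r_neq0 X0) ?implybT // -[LHS]powRr1 ?ltW //; congr (_ `^ _); field.
have h1 : 1 <= X `^ (1 / 2) by rewrite (le_trans _ hXA) // (le_trans _ A2) // ler1n.
exists x; split.
- apply/eqP => /rowP/(_ ord0); rewrite x0E mxE => /eqP; rewrite subr_eq0 => /eqP [] /val_inj.
  by move/eqP; rewrite (negPf tu).
- move=> j; case: (unliftP ord0 j) => [i ->|->]; last first.
    by rewrite (le_trans x0N) // [leRHS]XX ler_peMr // powR_ge0.
  have -> : (x 0 (lift ord0 i))%:~R = (x 0 ord0)%:~R * theta 0 i - (q t i - q u i).
    by rewrite -xq; ring.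
  have qN : `|q t i - q u i| <= 1 by rewrite (le_trans (qtu i)) // invf_le1 // ler1n.
  apply: le_trans (ler_normB _ _) _; rewrite normrM [leRHS]XX.
  apply: (@le_trans _ _ (X `^ (1 / 2) * `|theta 0 i| + X `^ (1 / 2))).
    by rewrite lerD // ?(le_trans qN) // ler_wpM2r.
  rewrite -[X in _ + X]mulr1 -mulrDr ler_wpM2l ?powR_ge0 //.
  exact: le_trans (thA i) hXA.
- by move=> i; rewrite xq (le_trans (qtu i)).
Qed.

Lemma line_basis (R : realType) (m : nat) (x : 'rV[int]_m) : x != 0 ->
  basis_mx <<rows (intr_mx R x)>> (intr_mx R x).
Proof.
move=> x0; apply: row_free_basis_mx; rewrite /row_free rank_rV.
suff -> : intr_mx R x != 0 by [].
apply: contra x0 => /eqP/rowP e; apply/eqP/rowP => i.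
by have := e i; rewrite !mxE => /eqP; rewrite intr_eq0 => /eqP.
Qed.

Lemma height_line_le (R : realType) (m : nat) (V : {vspace 'rV[R]_m}) (x : 'rV[int]_m) (s : R) :
  basis_mx V (intr_mx R x) -> 0 <= s -> (forall j, `|intr_mx R x 0 j| <= s) ->
  height V <= #|multiindex 1 m|%:R * s.
Proof.
move=> xV s0 xs; have := @height_le R _ _ V x 1 xV.
rewrite mulr1 => /(_ (fun=> dvd1n _)) /le_trans; apply; apply: l2norm_le => // I.
by rewrite -minor_intr /minor det_mx11 mxE.
Qed.

Lemma exists_max_entry (R : realType) (m : nat) (x : 'rV[R]_m) : x != 0 ->
  exists j, 0 < `|x 0 j| /\ forall i, `|x 0 i| <= `|x 0 j|.
Proof.
move=> x0.
have [i0 xi0] : exists i, x 0 i != 0.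
  apply: contrapT => h; case/eqP: x0; apply/rowP => i; rewrite mxE.
  by apply: contrapT => /eqP xi; apply: h; exists i.
have [j _ jmax] := @Order.TotalTheory.arg_maxP _ _ _ i0 xpredT (fun j => `|x 0 j|) isT.
exists j; split; last by move=> i; exact: jmax.
by rewrite (lt_le_trans _ (jmax i0 isT)) // normr_gt0.
Qed.

(** A point x that solves the uniform problem for X also satisfies
X^(-w) <= |x|^(-w), and H is at most a constant times |x| on the line through x.
The distances tend to 0 as X grows, which makes these lines infinitely many. *)
Lemma omega_hat0_le_omega0 (R : realType) (n : nat) (theta : 'rV[R]_n) (w : R) :
  lin_indep_over_Q (hcoord theta) -> (0 < n)%N -> 0 < w -> omega_hat0_set theta w ->
  (w%:E <= omega 0 theta)%E.
Proof.
move=> tQ n0 w0 /omega_hat0_set_defect[M HM].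
pose c1 : R := #|multiindex 1 n.+1|%:R; pose c2 : R := 2 * #|multiindex 2 n.+1|%:R.
have c20 : 0 <= c2 by rewrite mulr_ge0.
apply: (@omega_ge _ _ _ _ _ (c2 * c1 `^ (1 + w))) => // e e0.
have c2e : 0 < e / (c2 + 1) by rewrite divr_gt0 // ltr_pwDr.
have [H0 [H01 HH]] := powRN_eventually_lt c2e w0.
pose X := Num.max H0 (M + 1).
have XM : M < X by rewrite /X lt_max ltrDl ltr01 orbT.
have XH0 : H0 <= X by rewrite /X le_max lexx.
have X0 : 0 < X by rewrite (lt_le_trans _ XH0) // (lt_le_trans ltr01).
have [x [x0 xX xw]] := HM X XM.
pose V := <<rows (intr_mx R x)>>%VS; have xV := line_basis R x0 : basis_mx V _.
have rV := int_basis_rational xV.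
have dV : \dim V = 1 := dim_basis_mx xV.
have xV0 : intr_mx R x != 0.
  by have := basis_mx_row_free xV; rewrite /row_free rank_rV; case: (_ == 0).
have [j [xj0 xj]] := exists_max_entry xV0.
set s := `|intr_mx R x 0 j| in xj0 xj.
have s1 : 1 <= s by move: xj0; rewrite /s mxE -intr_norm ltr0z -[1]/(1%:~R) ler_int.
have dist : proj_dist_sub (hcoord theta) V <= c2 * (X `^ (- w) / s).
  apply: le_trans (proj_dist_le xj0 (lexx _) xw).
  by apply: proj_dist_sub_le => //; apply/(mem_basis_mx _ xV); exists 1%:M; rewrite mul1mx.
have hs : height V <= c1 * s := height_line_le xV (ltW xj0) xj.
have h1 := height_ge1 rV; have h0 : 0 < height V := lt_le_trans ltr01 h1.
exists V; split => //.
  apply: le_lt_trans dist _.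
  have HX := HH X XH0.
  apply: (@le_lt_trans _ _ ((c2 + 1) * X `^ (- w))).
    rewrite ler_pM ?divr_ge0 ?powR_ge0 ?lerDl // ?(ltW xj0) //.
    by rewrite ler_pdivrMr // ler_peMr // powR_ge0.
  by rewrite mulrC -ltr_pdivlMr // ltr_pwDr.
apply: le_trans dist _; rewrite -mulrA ler_wpM2l //.
have c10 : 0 < c1 by rewrite -(pmulr_lgt0 c1 xj0) (lt_le_trans h0).
rewrite -opprD !powRN.
have hp : 0 < height V `^ (1 + w) by rewrite powR_gt0.
rewrite (ler_pdivlMr _ _ hp) mulrC mulrA ler_pdivrMr // ler_pdivrMr ?powR_gt0 //.
apply: (@le_trans _ _ ((c1 * s) `^ (1 + w))).
  by apply: ge0_ler_powR => //; rewrite ?nnegrE ?addr_ge0 ?mulr_ge0 ?ltW.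
rewrite (powRM _ (ltW c10) (ltW xj0)) -!mulrA ler_pM2l ?powR_gt0 //.
rewrite powRD ?(lt0r_neq0 xj0) ?implybT // (powRr1 (ltW xj0)) ler_pM2l //.
by apply: ge0_ler_powR; rewrite ?nnegrE ?(ltW w0) ?(ltW xj0) ?(ltW X0) //; exact: xX.
Qed.

(** * Planes through two rational points *)

Lemma defectZ (R : realType) (n : nat) (theta : 'rV[R]_n) (c : R) P j :
  defect theta (c *: P) 0 j = c * defect theta P 0 j.
Proof. by rewrite !defectE !mxE; ring. Qed.

Lemma defectD (R : realType) (n : nat) (theta : 'rV[R]_n) P Q j :
  defect theta (P + Q) 0 j = defect theta P 0 j + defect theta Q 0 j.
Proof. by rewrite !defectE !mxE; ring. Qed.

(** An integer basis vector divided by the gcd of its entries. *)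
Lemma line_generator (R : realType) (m : nat) (V : {vspace 'rV[R]_m}) :
  rational_subspace V -> \dim V = 1 -> exists y : 'rV[int]_m,
    basis_mx V (intr_mx R y) /\ forall j, `|intr_mx R y 0 j| <= height V.
Proof.
move=> rV dV; have [B BV] := rational_subspace_int_basis rV; move: B BV; rewrite dV => B BV.
have g0 := minor_gcd_gt0 (basis_mx_row_free BV).
have g0' : (0 : R) < (minor_gcd B)%:R by rewrite ltr0n.
have inc j : increasing [ffun a : 'I_1 => j : 'I_m].
  by apply/forallP => a; apply/forallP => b; rewrite !ord1.
pose I j : multiindex 1 m := exist (fun g : {ffun _ -> _} => is_true (increasing g)) _ (inc j).
have BI j : minor B (val (I j)) = B 0 j by rewrite /minor det_mx11 mxE /= ffunE.
pose y : 'rV[int]_m := \row_j (B 0%R j %/ (minor_gcd B)%:Z)%Z.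
have yB : intr_mx R B = (minor_gcd B)%:R *: intr_mx R y.
  apply/rowP => j; rewrite !mxE -BI -{1}(@divzK (minor_gcd B)%:Z (minor B (val (I j)))).
    by rewrite intrM -pmulrn mulrC.
  by rewrite /dvdz; exact: minor_gcd_dvd.
exists y; split.
  apply: basis_mxP => //.
    move=> i; rewrite ord1 (_ : row 0 _ = intr_mx R y); last by apply/rowP => j; rewrite !mxE.
    apply/(mem_basis_mx _ BV).
    exists ((minor_gcd B)%:R^-1%:M).
    by rewrite mul_scalar_mx yB scalerA mulVf ?scale1r ?lt0r_neq0.
  have := basis_mx_row_free BV; rewrite yB /row_free mxrank_scale_nz //.
  exact: lt0r_neq0.
move=> j; rewrite -(ler_pM2r g0').
apply: le_trans (minor_gcd_le_height (I j) BV).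
rewrite BI (_ : (B 0 j)%:~R = intr_mx R B 0 j); last by rewrite mxE.
by rewrite yB [X in _ <= `|X|]mxE normrM [`|_%:R|]ger0_norm // mulrC.
Qed.

Lemma minor_col_mx2 (A : comNzRingType) (m : nat) (x y : 'rV[A]_m) (f : 'I_(1 + 1) -> 'I_m) :
  minor (col_mx x y) f = x 0 (f 0) * y 0 (f 1) - x 0 (f 1) * y 0 (f 0).
Proof.
rewrite minor_col_mx !big_ord_recl big_ord0 /= /minor !det_mx11 !mxE /= expr0 expr1.
rewrite addr0 mul1r mulN1r mulrN.
by congr (x 0 (f _) * y 0 (f _) - x 0 (f _) * y 0 (f _)); apply: val_inj.
Qed.

Lemma row_combE (A : pzRingType) (m : nat) (a b : A) (u w : 'rV[A]_m) j :
  (a *: u + b *: w) 0 j = a * u 0 j + b * w 0 j.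
Proof. by rewrite !mxE. Qed.

(** Put v = x_0 y - y_0 x = x_0 r(y) - y_0 r(x), where r is the defect. Up to
constants |v| is the norm of x /\ y, since
y_0 (x_i y_j - x_j y_i) = y_i v_j - y_j v_i and y_0 is of the order of |y|; this
bounds the height. The point P = <r(y), v> x - <r(x), v> y of the plane has first
coordinate P_0 = |v|^2 and defect << |r(x)| |r(y)| |v|, so that the distance from
T to P is << |r(x)| |r(y)| / |v|. *)
Lemma plane_through (R : realType) (n : nat) (theta : 'rV[R]_n) : exists c : R, 0 < c /\
  forall (x y : 'rV[int]_n.+1) (V : {vspace 'rV[R]_n.+1}) (X Y K rx ry : R),
    basis_mx V (intr_mx R y) -> intr_mx R x \notin V ->
    `|intr_mx R x 0 ord0| <= X -> (forall j, `|intr_mx R y 0 j| <= Y) ->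
    Y <= K * `|intr_mx R y 0 ord0| ->
    (forall j, `|defect theta (intr_mx R x) 0 j| <= rx) ->
    (forall j, `|defect theta (intr_mx R y) 0 j| <= ry) ->
    exists W : {vspace 'rV[R]_n.+1}, [/\ rational_subspace W, \dim W = 2,
      height W <= c * K * (X * ry + Y * rx) &
      proj_dist_sub (hcoord theta) W * height W <= c * K * (rx * ry)].
Proof.
pose c6 : R := #|multiindex 2 n.+1|%:R; have c60 : 0 <= c6 by [].
pose c := 8 * c6 ^+ 2 * n.+1%:R + 2 * c6 + 1.
have cc0 : 0 <= 8 * c6 ^+ 2 * n.+1%:R by rewrite !mulr_ge0 // exprn_ge0.
exists c; split; first by rewrite ltr_pwDr // addr_ge0 // mulr_ge0.
move=> x y V X Y K rx ry yV xV xX yY YK xr yr.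
set xR := intr_mx R x in xV xX xr *; set yR := intr_mx R y in yV yY YK yr *.
set x0 := xR 0 ord0 in xX *; set y0 := yR 0 ord0 in YK *.
have yRV : yR \in V by apply/(mem_basis_mx _ yV); exists 1%:M; rewrite mul1mx.
have yR0 : yR != 0.
  by have := basis_mx_row_free yV; rewrite /row_free rank_rV; case: (_ == 0).
have [j1 [yj1 _]] := exists_max_entry yR0.
have Y0 : 0 < Y := lt_le_trans yj1 (yY j1).
have y00 : y0 != 0 by apply: contraTneq YK => ->; rewrite normr0 mulr0 -ltNge.
have y0p : 0 < `|y0| by rewrite normr_gt0.
have y0Y : `|y0| <= Y := yY ord0.
have K0 : 0 < K by rewrite -(pmulr_lgt0 K y0p) (lt_le_trans Y0).
have X0 : 0 <= X := le_trans (normr_ge0 _) xX.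
have rx0 : 0 <= rx := le_trans (normr_ge0 _) (xr ord0).
have ry0 : 0 <= ry := le_trans (normr_ge0 _) (yr ord0).
pose v : 'rV[R]_n.+1 := x0 *: yR - y0 *: xR.
have vE' j : v 0 j = x0 * yR 0 j - y0 * xR 0 j.
  by rewrite /v -scaleNr row_combE mulNr.
have vE j : v 0 j = x0 * defect theta yR 0 j - y0 * defect theta xR 0 j.
  by rewrite vE' !defectE -/x0 -/y0; ring.
have v0 : v != 0.
  apply: contra xV => /eqP /subr0_eq e.
  have -> : xR = y0^-1 *: (x0 *: yR) by rewrite e scalerA mulVf ?scale1r.
  by rewrite !memvZ.
have [j0 [mu0 vmu]] := exists_max_entry v0; set mu := `|v 0 j0| in mu0 vmu.
have muXY : mu <= X * ry + Y * rx.
  rewrite /mu vE; apply: le_trans (ler_normB _ _) _; rewrite !normrM.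
  by rewrite lerD ?ler_pM.
have [W [VW WB]] := rational_extension yV xV.
have rW := int_basis_rational WB.
have hW : height W <= c6 * (2 * K * mu).
  have := @height_le R _ _ W _ 1 WB (fun=> dvd1n _).
  rewrite mulr1 => /le_trans; apply; apply: l2norm_le => [|I].
    by rewrite !mulr_ge0 // ltW.
  rewrite -minor_intr /intr_mx map_col_mx minor_col_mx2 -/(intr_mx R x) -/(intr_mx R y).
  rewrite -/xR -/yR; move: (val I 0) (val I 1) => i j.
  rewrite -(ler_pM2l y0p) -normrM.
  have -> : y0 * (xR 0 i * yR 0 j - xR 0 j * yR 0 i) = yR 0 i * v 0 j - yR 0 j * v 0 i.
    by rewrite !vE'; ring.
  apply: le_trans (ler_normB _ _) _; rewrite !normrM.
  have -> : `|y0| * (2 * K * mu) = K * `|y0| * mu + K * `|y0| * mu by ring.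
  by rewrite lerD // ler_pM // (le_trans (yY _)).
have hW1 := height_ge1 rW.
pose al := \sum_i defect theta yR 0 i * v 0 i.
pose be := - \sum_i defect theta xR 0 i * v 0 i.
pose P := al *: xR + be *: yR.
have al_le : `|al| <= n.+1%:R * (ry * mu).
  apply: le_trans (ler_norm_sum _ _ _) _.
  apply: (@le_trans _ _ (\sum_(i < n.+1) ry * mu)).
    by apply: ler_sum => i _; rewrite normrM ler_pM.
  by rewrite sumr_const card_ord [leRHS]mulr_natl.
have be_le : `|be| <= n.+1%:R * (rx * mu).
  rewrite normrN; apply: le_trans (ler_norm_sum _ _ _) _.
  apply: (@le_trans _ _ (\sum_(i < n.+1) rx * mu)).
    by apply: ler_sum => i _; rewrite normrM ler_pM.
  by rewrite sumr_const card_ord [leRHS]mulr_natl.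
have P0 : P 0 ord0 = \sum_i v 0 i ^+ 2.
  have -> : P 0 ord0 = al * x0 + be * y0 by rewrite /P row_combE.
  rewrite mulNr /al /be !mulr_suml -sumrB; apply: eq_bigr => i _.
  by rewrite expr2 {3}vE; ring.
have Pmu : mu ^+ 2 <= `|P 0 ord0|.
  rewrite P0 ger0_norm; last by apply: sumr_ge0 => i _; rewrite sqr_ge0.
  rewrite (bigD1 j0) //= real_normK ?num_real // lerDl.
  by apply: sumr_ge0 => i _; rewrite sqr_ge0.
have mu2 : 0 < mu ^+ 2 by rewrite exprn_gt0.
have Pr j : `|defect theta P 0 j| <= 2 * n.+1%:R * (rx * ry) * mu.
  rewrite defectD !defectZ; apply: le_trans (ler_normD _ _) _; rewrite !normrM.
  have -> : 2 * n.+1%:R * (rx * ry) * mu =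
    n.+1%:R * (ry * mu) * rx + n.+1%:R * (rx * mu) * ry by ring.
  by rewrite lerD ?ler_pM.
have PW : P \in W.
  by rewrite memvD // memvZ //; [|exact: subvP yRV];
    apply/(mem_basis_mx _ WB); exists (row_mx 1%:M 0);
    rewrite /intr_mx map_col_mx mul_row_col mul1mx mul0mx addr0.
have Pn0 : P != 0.
  by apply: contraTneq Pmu => ->; rewrite mxE normr0 -ltNge.
have dW : proj_dist_sub (hcoord theta) W <= 2 * c6 * (2 * n.+1%:R * (rx * ry) * mu / mu ^+ 2).
  exact: le_trans (proj_dist_sub_le _ PW Pn0) (proj_dist_le mu2 Pmu Pr).
exists W; split; [exact: rW|exact: dim_basis_mx WB| |].
- apply: le_trans hW _; have -> : c6 * (2 * K * mu) = 2 * c6 * K * mu by ring.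
  rewrite ler_pM // ?mulr_ge0 // ?(ltW K0) ?(ltW mu0) //.
  rewrite ler_wpM2r ?(ltW K0) // /c addrAC lerDr addr_ge0 //.
- have W0 : 0 <= height W := le_trans ler01 hW1.
  apply: (@le_trans _ _ (2 * c6 * (2 * n.+1%:R * (rx * ry) * mu / mu ^+ 2) * (c6 * (2 * K * mu)))).
    apply: (@le_trans _ _ (2 * c6 * (2 * n.+1%:R * (rx * ry) * mu / mu ^+ 2) * height W)).
      by rewrite ler_wpM2r.
    by rewrite ler_wpM2l // !mulr_ge0 ?invr_ge0 ?(ltW mu0) ?(ltW mu2).
  have -> : 2 * c6 * (2 * n.+1%:R * (rx * ry) * mu / mu ^+ 2) * (c6 * (2 * K * mu)) =
    (8 * c6 ^+ 2 * n.+1%:R) * K * (rx * ry) by field; exact: lt0r_neq0.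
  rewrite ler_wpM2r ?mulr_ge0 // ler_wpM2r ?(ltW K0) // /c -addrA lerDl addr_ge0 //.
  by rewrite mulr_ge0.
Qed.

(** The line V of large height H with d(T, V) <= H^(-1-w) is spanned by a primitive
y with entries at most H and defect << H^(-w). The uniform problem for
X = H / (2 c1) provides x with defect << H^(-h), and x is not on V because every
nonzero integer point of V has an entry of size at least H / c1. *)
Lemma good_planes (R : realType) (n : nat) (theta : 'rV[R]_n) (h w : R) :
  0 < h -> h <= w -> omega_hat0_set theta h -> infinite_set (omega_set 0 theta w) ->
  exists C : R, 0 < C /\ forall H0 : R, exists (H : R) (W : {vspace 'rV[R]_n.+1}),
    [/\ H0 <= H, rational_subspace W, \dim W = 2, height W <= C * H `^ (1 - h) &
        proj_dist_sub (hcoord theta) W * height W <= C * H `^ (- (w + h))].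
Proof.
move=> h0 hw /omega_hat0_set_defect[M HM] inf.
have w0 : 0 < w := lt_le_trans h0 hw.
pose Tn := l2norm (hcoord theta 0).
have Tn1 : 1 <= Tn by rewrite -[leLHS]normr1 -(hcoord0 theta); exact: l2norm_ge.
have Tn0 : 0 < Tn := lt_le_trans ltr01 Tn1.
pose c1 : R := #|multiindex 1 n.+1|%:R + 1.
have c10 : 0 < c1 by rewrite ltr_pwDr.
have c1_line (V : {vspace 'rV[R]_n.+1}) (z : 'rV[int]_n.+1) s : basis_mx V (intr_mx R z) ->
    0 <= s -> (forall j, `|intr_mx R z 0 j| <= s) -> height V <= c1 * s.
  move=> zV s0 zs; apply: le_trans (height_line_le zV s0 zs) _.
  by rewrite ler_wpM2r // lerDl.
pose c2 : R := 2 * n.+1%:R * Tn.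
have c20 : 0 < c2 by rewrite !mulr_gt0.
pose K : R := 2 * c1 * Tn; have K0 : 0 < K by rewrite !mulr_gt0.
pose c4 : R := (2 * c1)^-1 `^ (- h).
have c11 : 0 < (2 * c1)^-1 by rewrite invr_gt0 mulr_gt0.
have c40 : 0 < c4 by rewrite powR_gt0.
have [c [c0 Hc]] := plane_through theta.
exists (c * K * (c2 + c4) + c * K * (c4 * c2)).
have t1 : 0 < c * K * (c2 + c4) by rewrite !mulr_gt0 // addr_gt0.
have t2 : 0 < c * K * (c4 * c2) by rewrite !mulr_gt0.
split; first by rewrite addr_gt0.
move=> H0.
have c2V : 0 < c2^-1 by rewrite invr_gt0.
have [H1 [H11 HH1]] := powRN_eventually_lt c2V w0.
have [V [rV dV Vw] VH] := omega_set_large (Num.max (Num.max H0 H1) (Num.max (2 * c1) (2 * c1 * M))) inf.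
set H := height V in Vw VH.
move: VH; rewrite !gt_max => /andP[/andP[HH0 HH1'] /andP[Hc1 HM']].
have H1H : H1 <= H by exact: ltW.
have Hge1 : 1 <= H := le_trans H11 H1H.
have Hp : 0 < H := lt_le_trans ltr01 Hge1.
have Hn0 := lt0r_neq0 Hp.
have powHD a b : H `^ (a + b) = H `^ a * H `^ b by rewrite powRD // Hn0 implybT.
have [y [yV yH]] := line_generator rV dV.
have yr j : `|defect theta (intr_mx R y) 0 j| <= c2 * H `^ (- w).
  have Vw2 : proj_dist_sub (hcoord theta) V < 2 * H `^ (- 1 - w).
    by rewrite (le_lt_trans Vw) // ltr_pMl ?powR_gt0 // ltr1n.
  have [|P [PV P0 Plt]] := proj_dist_sub_lt _ Vw2; first by rewrite dV.
  have [a Pa] : exists a, P = a *: intr_mx R y.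
    have /(mem_basis_mx _ yV)[u ->] := PV.
    by exists (u 0 0); rewrite [u in LHS]mx11_scalar mul_scalar_mx.
  have a0 : 0 < `|a|.
    by rewrite normr_gt0; apply: contraNneq P0 => a0; rewrite Pa a0 scale0r.
  have Pl : l2norm (P 0) <= n.+1%:R * (`|a| * H).
    rewrite -[n.+1 in leRHS]card_ord; apply: l2norm_le => [|i].
      by rewrite mulr_ge0 // ltW.
    by rewrite Pa mxE normrM ler_wpM2l.
  have := defect_le theta j P0; rewrite Pa defectZ normrM -Pa => le1.
  rewrite -(ler_pM2l a0) (le_trans le1) //.
  apply: (@le_trans _ _ (2 * H `^ (- 1 - w) * (Tn * (n.+1%:R * (`|a| * H))))).
    apply: ler_pM; [exact: proj_dist_ge0| |exact: ltW|].
      by rewrite mulr_ge0 ?l2norm_ge0 // ltW.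
    by rewrite ler_wpM2l // ltW.
  rewrite powHD; set E := H `^ (- w); rewrite powRN (powRr1 (ltW Hp)).
  rewrite -subr_ge0 (_ : _ - _ = 0) //.
  by rewrite /c2; field.
have yV0 : intr_mx R y != 0.
  by have := basis_mx_row_free yV; rewrite /row_free rank_rV; case: (_ == 0).
(* the defect of y is at most 1, so y_0 has the order of magnitude of y *)
have ry1 : c2 * H `^ (- w) <= 1.
  by rewrite mulrC -ler_pdivlMr // mul1r ltW // HH1.
have yK : H <= K * `|intr_mx R y 0 ord0|.
  have [j [yj yjm]] := exists_max_entry yV0.
  have Hj : H <= c1 * `|intr_mx R y 0 j| by exact: c1_line yV (ltW yj) yjm.
  have yj1 : `|intr_mx R y 0 j| <= `|intr_mx R y 0 ord0| * Tn + 1.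
    have -> : intr_mx R y 0 j = intr_mx R y 0 ord0 * hcoord theta 0 j +
      defect theta (intr_mx R y) 0 j by rewrite defectE; ring.
    apply: le_trans (ler_normD _ _) _; rewrite normrM lerD //.
      by rewrite ler_wpM2l // l2norm_ge.
    exact: le_trans (yr j) ry1.
  have := le_trans Hj (ler_wpM2l (ltW c10) yj1).
  rewrite /K; move: Hc1; set a := `|_|; move=> ? ?.
  have -> : 2 * c1 * Tn * a = c1 * (a * Tn + 1) * 2 - 2 * c1 by ring.
  lra.
pose X := H / (2 * c1).
have c12 : 0 < 2 * c1 by rewrite mulr_gt0.
have XM : M < X by rewrite /X ltr_pdivlMr // mulrC.
have X0 : 0 < X by rewrite divr_gt0.
have [x [x0 xX xr]] := HM X XM.
have XE : c1 * X = H / 2 by rewrite /X; field; exact: lt0r_neq0.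
have xV : intr_mx R x \notin V.
  apply/negP => xV.
  have xB : basis_mx V (intr_mx R x).
    apply: basis_mxP => //; last exact: basis_mx_row_free (line_basis R x0).
    by move=> i; rewrite ord1 (_ : row 0 _ = intr_mx R x) //; apply/rowP => j; rewrite !mxE.
  have := c1_line _ _ _ xB (ltW X0) xX; rewrite -/H XE; lra.
have XH : X <= H.
  rewrite /X ler_pdivrMr // ler_peMr // ?ltW // /c1.
  have : 0 <= #|multiindex 1 n.+1|%:R :> R by []. lra.
have xr' j : `|defect theta (intr_mx R x) 0 j| <= c4 * H `^ (- h).
  apply: le_trans (xr j) _; rewrite /X powRM ?(ltW Hp) ?(ltW c11) //.
  by rewrite mulrC.
have xX0 : `|intr_mx R x 0 ord0| <= H := le_trans (xX _) XH.
have [W [rW dW hW dhW]] := Hc x y V H H K _ _ yV xV xX0 yH yK xr' yr.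
exists H, W; split; [exact: ltW|exact: rW|exact: dW| |].
- apply: le_trans hW _.
  apply: (@le_trans _ _ (c * K * (c2 + c4) * H `^ (1 - h))); last first.
    by rewrite ler_wpM2r ?powR_ge0 // lerDl ltW.
  rewrite -[leRHS]mulrA (ler_pM2l (mulr_gt0 c0 K0)).
  rewrite powHD (powRr1 (ltW Hp)).
  have Hwh : H `^ (- w) <= H `^ (- h) by rewrite ler_powR // lerN2.
  have -> : (c2 + c4) * (H * H `^ (- h)) = H * (c2 * H `^ (- h)) + H * (c4 * H `^ (- h)) by ring.
  by rewrite lerD2r !ler_wpM2l // ?(ltW Hp) ?(ltW c20).
- apply: le_trans dhW _.
  apply: (@le_trans _ _ (c * K * (c4 * c2) * H `^ (- (w + h)))); last first.
    by rewrite ler_wpM2r ?powR_ge0 // lerDr ltW.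
  by rewrite opprD powHD -subr_ge0 (_ : _ - _ = 0) //; ring.
Qed.

(** Otherwise the planes of [good_planes] would have height less than 1. *)
Lemma omega_hat0_set_le1 (R : realType) (n : nat) (theta : 'rV[R]_n) (h w : R) :
  0 < h -> h <= w -> omega_hat0_set theta h -> infinite_set (omega_set 0 theta w) -> h <= 1.
Proof.
move=> h0 hw hh inf; have [C [C0 HC]] := good_planes h0 hw hh inf.
rewrite leNgt; apply/negP => h1.
have CV : 0 < C^-1 by rewrite invr_gt0.
have h10 : 0 < h - 1 by rewrite subr_gt0.
have [H0 [_ HH]] := powRN_eventually_lt CV h10.
have [H [W [HH0 rW _ hW _]]] := HC H0.
have := HH H HH0; rewrite opprB -(ltr_pM2l C0) divff ?lt0r_neq0 // => lt1.
by have := lt_le_trans (le_lt_trans hW lt1) (height_ge1 rW); rewrite ltxx.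
Qed.

(** Eliminate H between the two estimates of [good_planes]. *)
Lemma omega1_ge (R : realType) (n : nat) (theta : 'rV[R]_n) (h w : R) :
  lin_indep_over_Q (hcoord theta) -> (1 < n)%N ->
  0 < h -> h <= w -> h < 1 -> omega_hat0_set theta h -> infinite_set (omega_set 0 theta w) ->
  (((w + h) / (1 - h))%:E <= omega 1 theta)%E.
Proof.
move=> tQ n1 h0 hw h1 hh inf; have [C [C0 HC]] := good_planes h0 hw hh inf.
set w1 := (w + h) / (1 - h).
have h10 : 0 < 1 - h by rewrite subr_gt0.
have wh0 : 0 < w + h by rewrite addr_gt0 // (lt_le_trans h0).
have w10 : 0 < w1 by rewrite divr_gt0.
have w1E : (1 - h) * w1 = w + h by rewrite /w1 mulrC divfK // lt0r_neq0.
apply: (@omega_ge _ _ _ _ _ (C * C `^ w1)) => // e e0.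
have eC : 0 < e / C by rewrite divr_gt0.
have [H0 [H01 HH]] := powRN_eventually_lt eC wh0.
have [H [W [HH0 rW dW hW dhW]]] := HC H0.
have Hge1 : 1 <= H := le_trans H01 HH0.
have Hp : 0 < H := lt_le_trans ltr01 Hge1.
have W1 := height_ge1 rW; have W0 : 0 < height W := lt_le_trans ltr01 W1.
have d0 : 0 < proj_dist_sub (hcoord theta) W.
  by apply: proj_dist_sub_gt0; [exact: tQ|exact: rW|rewrite dW].
exists W; split; [exact: rW|exact: dW| |].
  apply: (@le_lt_trans _ _ (proj_dist_sub (hcoord theta) W * height W)).
    by rewrite ler_peMr // ltW.
  by apply: le_lt_trans dhW _; rewrite mulrC -ltr_pdivlMr //; exact: HH.
rewrite powRD ?(lt0r_neq0 W0) ?implybT // !powRN (powRr1 (ltW W0)).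
rewrite mulrCA -ler_pdivrMl ?invr_gt0 // invrK mulrC (le_trans dhW) //.
rewrite powRN -w1E powRrM -mulrA ler_wpM2l ?(ltW C0) //.
have p1 : 0 < H `^ (1 - h) by rewrite powR_gt0.
have p2 : 0 < height W `^ w1 by rewrite powR_gt0.
have p3 : 0 < (H `^ (1 - h)) `^ w1 by rewrite powR_gt0.
rewrite (ler_pdivlMr _ _ p2) mulrC (ler_pdivrMr _ _ p3) -powRM ?(ltW C0) ?(ltW p1) //.
by apply: ge0_ler_powR; rewrite ?nnegrE ?(ltW w10) ?(ltW W0) ?mulr_ge0 ?(ltW C0) ?(ltW p1).
Qed.

(** * The transfer inequalities *)

Lemma omega_ub (R : realType) (n d : nat) (theta : 'rV[R]_n) (M : R) :
  (forall w, infinite_set (omega_set d theta w) -> w <= M) -> (omega d theta <= M%:E)%E.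
Proof. by move=> H; apply: ge_ereal_sup => _ [w /= /H wM <-]; rewrite lee_fin. Qed.

Lemma omega_adherent (R : realType) (n d : nat) (theta : 'rV[R]_n) (x : R) :
  (x%:E < omega d theta)%E -> exists2 w, infinite_set (omega_set d theta w) & x < w.
Proof. by case/ereal_sup_gt => _ [w /= inf <-]; rewrite lte_fin => xw; exists w. Qed.

Lemma omega_hat0_adherent (R : realType) (n : nat) (theta : 'rV[R]_n) (x : R) :
  (x%:E < omega_hat0 theta)%E -> exists2 w, omega_hat0_set theta w & x < w.
Proof. by case/ereal_sup_gt => _ [w /= inf <-]; rewrite lte_fin => xw; exists w. Qed.

(** Positivity starts with the uniform exponent of [dirichlet] and is preserved when
going up. *)
Lemma omega_gt0 (R : realType) (n d : nat) (theta : 'rV[R]_n) :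
  lin_indep_over_Q (hcoord theta) -> (d < n)%N -> (0 < omega d theta)%E.
Proof.
move=> tQ; elim: d => [|d IH] dn.
  have [w w0 hw] := dirichlet theta dn.
  apply: lt_le_trans (omega_hat0_le_omega0 tQ dn w0 hw).
  by rewrite lte_fin.
have [w inf w0] := omega_adherent (IH (ltnW dn)).
apply: lt_le_trans (omega_going_up tQ dn w0 inf).
have r0 : (0 : R) < (n - d)%N%:R by rewrite ltr0n; lia.
have r1 : (0 : R) < (n - d - 1)%N%:R by rewrite ltr0n; lia.
by rewrite lte_fin divr_gt0 // addr_gt0 // mulr_gt0.
Qed.

Lemma omega_going_up_inequality (R : realType) (n d : nat) (theta : 'rV[R]_n) :
  lin_indep_over_Q (hcoord theta) -> (d.+1 < n)%N ->
  (((n - d)%N%:R%:E * omega d theta + 1) / (n - d - 1)%N%:R%:E <= omega d.+1 theta)%E.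
Proof.
move=> tQ dn.
have r0 : (0 : R) < (n - d)%N%:R by rewrite ltr0n; lia.
have r1 : (0 : R) < (n - d - 1)%N%:R by rewrite ltr0n; lia.
have dn' : (d < n)%N := ltnW dn.
have := omega_gt0 tQ dn; case E1 : (omega d.+1 theta) => [s| |] //; last by rewrite leey.
rewrite lte_fin => s0.
have [w0 inf0 w00] := omega_adherent (omega_gt0 tQ dn').
have bound w : 0 < w -> infinite_set (omega_set d theta w) ->
    w <= (s * (n - d - 1)%N%:R - 1) / (n - d)%N%:R.
  move=> wp inf; have := omega_going_up tQ dn wp inf.
  by rewrite E1 lee_fin ler_pdivrMr // ler_pdivlMr // lerBrDr mulrC.
have : (omega d theta <= ((s * (n - d - 1)%N%:R - 1) / (n - d)%N%:R)%:E)%E.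
  apply: omega_ub => w inf; have [wp|wn] := ltP 0 w; first exact: bound.
  exact: le_trans (le_trans wn (ltW w00)) (bound _ w00 inf0).
have := omega_gt0 tQ dn'; case: (omega d theta) => [t| |] //.
rewrite lte_fin lee_fin => t0 ts.
rewrite inver gt_eqF // -EFinM lee_fin ler_pdivrMr //.
by move: ts; rewrite ler_pdivlMr // lerBrDr mulrC.
Qed.

(** Let s be the value of omega_1 if it is finite. For admissible exponents
0 < h <= w one has w + h <= s (1 - h), which forces h < 1 and w <= s. Passing to
the suprema requires h <= w, and this is arranged by replacing h by min(h, w),
which costs nothing in the limit because omega_hat0 <= omega_0. *)
Lemma omega1_uniform_inequality (R : realType) (n : nat) (theta : 'rV[R]_n) :
  lin_indep_over_Q (hcoord theta) -> (1 < n)%N ->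
  ((if (omega 0 theta == +oo) || (omega_hat0 theta == 1) then +oo
    else (omega 0 theta + omega_hat0 theta) / (1 - omega_hat0 theta))
    <= omega 1 theta)%E.
Proof.
move=> tQ n1; have n0 := ltnW n1.
have := omega_gt0 tQ n1; case E1 : (omega 1 theta) => [s| |] //; last by rewrite leey.
rewrite lte_fin => s0.
have key1 h w : 0 < h -> h <= w -> h < 1 -> omega_hat0_set theta h ->
    infinite_set (omega_set 0 theta w) -> w + h <= s * (1 - h).
  move=> hp hw h1 hh inf; have := omega1_ge tQ n1 hp hw h1 hh inf.
  by rewrite E1 lee_fin ler_pdivrMr // subr_gt0.
have key h w : 0 < h -> h <= w -> omega_hat0_set theta h ->
    infinite_set (omega_set 0 theta w) -> w + h <= s * (1 - h).
  move=> hp hw hh inf; have := omega_hat0_set_le1 hp hw hh inf.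
  rewrite le_eqVlt => /orP[/eqP h1|h1]; last exact: key1.
  (* for h = 1, the exponent 1 - 1 / (s + 1) would already give w <= 0 *)
  pose eta := (s + 1)^-1.
  have s1 : 0 < s + 1 by rewrite addr_gt0.
  have eta0 : 0 < eta by rewrite invr_gt0.
  have eta1 : eta < 1 by rewrite invf_lt1 // ltrDr.
  have etaE : s * eta = 1 - eta by rewrite /eta; field; rewrite gt_eqF.
  have lt1 : 1 - eta < 1 by rewrite ltrBlDr ltrDl.
  have lt0 : 0 < 1 - eta by rewrite subr_gt0.
  have leh : 1 - eta <= h by rewrite h1 ltW.
  have := key1 _ _ lt0 (le_trans leh hw) lt1 (omega_hat0_set_le leh hh) inf.
  have w1 : 1 <= w by rewrite -h1.
  rewrite subKr etaE; lra.
have [h0 h00 hh0] := dirichlet theta n0.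
have t_ge0 := omega_hat0_le_omega0 tQ n0 h00 hh0.
have : (omega 0 theta <= s%:E)%E.
  apply: omega_ub => w inf; have [wp|wn] := ltP 0 w; last exact: le_trans wn (ltW s0).
  have hm0 : 0 < Num.min h0 w by rewrite lt_min h00.
  have hmw : Num.min h0 w <= w by rewrite ge_min lexx orbT.
  have hmh : Num.min h0 w <= h0 by rewrite ge_min lexx.
  have := key _ _ hm0 hmw (omega_hat0_set_le hmh hh0) inf.
  nra.
case E0 : (omega 0 theta) t_ge0 => [t| |] //; rewrite !lee_fin => h0t ts.
have hat_ub : (omega_hat0 theta <= t%:E)%E.
  apply: ge_ereal_sup => _ [h /= hh <-]; rewrite lee_fin.
  have [hp|hn] := ltP 0 h; last by rewrite (le_trans hn) // (le_trans (ltW h00)).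
  by have := omega_hat0_le_omega0 tQ n0 hp hh; rewrite E0 lee_fin.
have hat_lb : (h0%:E <= omega_hat0 theta)%E by apply: ereal_sup_ubound; exists h0.
case Eh : (omega_hat0 theta) hat_ub hat_lb => [a| |] //; rewrite !lee_fin => at_ h0a.
have a0 : 0 < a := lt_le_trans h00 h0a.
have main : t + a <= s * (1 - a).
  apply/ler_addgt0Pr => e e0.
  (* eps <= a / 2 keeps the exponents positive, and eps (2 + s) is the total loss *)
  pose eps := Num.min (a / 2) (e / (2 + s)).
  have s20 : 0 < 2 + s by rewrite addr_gt0.
  have eps0 : 0 < eps by rewrite lt_min !divr_gt0.
  have epsa : eps <= a / 2 by rewrite ge_min lexx.
  have epse : eps * (2 + s) <= e by rewrite -ler_pdivlMr // ge_min lexx orbT.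
  have [h hh ah] : exists2 h, omega_hat0_set theta h & a - eps < h.
    by apply: omega_hat0_adherent; rewrite Eh lte_fin ltrBlDr ltrDl.
  have [w inf tw] : exists2 w, infinite_set (omega_set 0 theta w) & t - eps < w.
    by apply: omega_adherent; rewrite E0 lte_fin ltrBlDr ltrDl.
  have am : a - eps < Num.min h w by rewrite lt_min ah (le_lt_trans _ tw) // lerD2r.
  have hmw : Num.min h w <= w by rewrite ge_min lexx orbT.
  have hmh : Num.min h w <= h by rewrite ge_min lexx.
  have m0 : 0 < Num.min h w by apply: le_lt_trans am; lra.
  have := key _ _ m0 hmw (omega_hat0_set_le hmh hh) inf.
  nra.
have a1 : a < 1 by nra.
have -> : (t%:E == +oo)%E = false by [].
have -> : (a%:E == 1)%E = false by rewrite eqe lt_eqF.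
rewrite /= -EFinB inver gt_eqF ?subr_gt0 // -EFinD -EFinM lee_fin.
by rewrite ler_pdivrMr // subr_gt0.
Qed.

Local Open Scope ereal_scope.

Theorem theorem2 (R : realType) (n : nat) (theta : 'rV[R]_n)
    (hn : (2 <= n)%N) (htheta : lin_indep_over_Q (hcoord theta)) :
  (forall d : nat, (d <= n - 2)%N ->
     ((n - d)%N%:R%:E * omega d theta + 1) / (n - d - 1)%N%:R%:E
       <= omega d.+1 theta) /\
  (if (omega 0 theta == +oo) || (omega_hat0 theta == 1) then +oo
   else (omega 0 theta + omega_hat0 theta) / (1 - omega_hat0 theta))
    <= omega 1 theta.
Proof.
split; last exact: omega1_uniform_inequality.
move=> d dn; apply: omega_going_up_inequality => //; lia.
Qed.
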